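(* Let $p,q>2$. For $\lambda\in\mathbb{R}$ consider the problem $$(P_\lambda)\qquad \begin{cases} u''-|u|^{p-2}u=\lambda u & \text{on }\mathbb{R}\setminus\{0\},\\ u'(0^-)-u'(0^+)=|u(0)|^{q-2}u(0).\end{cases}$$ For every $\lambda\in\mathbb{R}$, if $u\in H^1(\mathbb{R})$ is a nontrivial solution of $(P_\lambda)$, then $u$ is even and, up to a change of sign, positive and radially decreasing on $\mathbb{R}$. Moreover: (i) when $\lambda<0$, $(P_\lambda)$ has no nontrivial solution in $H^1(\mathbb{R})$; (ii) when $\lambda=0$, $(P_\lambda)$ has a positive solution in $H^1(\mathbb{R})$ if and only if $p\in(2,6)$ and $q\neq\frac p2+1$, and this solution is unique; (iii) when $\lambda>0$: (a) if $q>\frac p2+1$, $(P_\lambda)$ has a unique positive solution in $H^1(\mathbb{R})$; (b) if $q=\frac p2+1$, $(P_\lambda)$ has a positive solution in $H^1(\mathbb{R})$ if and only if $p>8$, and this solution is unique; (c) if $q<\frac p2+1$, there exists $\overline{\lambda}_{p,q}>0$ such that $(P_\lambda)$ has no nontrivial solution in $H^1(\mathbb{R})$ when $\lambda>\overline{\lambda}_{p,q}$, it has a unique positive solution in $H^1(\mathbb{R})$ when $\lambda=\overline{\lambda}_{p,q}$, and it has exactly two positive solutions in $H^1(\mathbb{R})$ when $\lambda\in(0,\overline{\lambda}_{p,q})$.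
   Context: Functions are real-valued. $u'(0^-),u'(0^+)$ denote the left and right derivatives of $u$ at the origin. Solutions in $H^1(\mathbb{R})$ are understood in the weak sense: $u\in H^1(\mathbb{R})$ solves $(P_\lambda)$ if $\int_{\mathbb{R}}u'\varphi'\,dx+\int_{\mathbb{R}}|u|^{p-2}u\varphi\,dx-|u(0)|^{q-2}u(0)\varphi(0)=-\lambda\int_{\mathbb{R}}u\varphi\,dx$ for every $\varphi\in H^1(\mathbb{R})$. Nontrivial means not identically zero. *)

(* Defs.v *)
From HB Require Import structures.
From mathcomp Require Import all_boot all_order all_algebra.
From mathcomp Require Import all_classical all_reals all_analysis.
Import Order.TTheory GRing.Theory Num.Theory.
Import numFieldNormedType.Exports.

Set Implicit Arguments.
Unset Strict Implicit.
Unset Printing Implicit Defensive.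

Local Open Scope classical_set_scope.
Local Open Scope ring_scope.

Section defs.
Context {R : realType}.
Notation mu := (@lebesgue_measure R).
Implicit Types (u v du phi dphi : R -> R) (p q lambda : R).

Definition L2 : set (R -> R) := [set u : R -> R | u \in Lfun mu 2%:E].

Definition C1c : set (R -> R) := [set phi : R -> R |
  [/\ forall x, derivable phi x 1, continuous (derive1 phi) &
      compact (closure [set x | phi x != 0])]].

(* Weak derivative tested against C^1_c(R), as in Brezis, "Functional Analysis,
   Sobolev Spaces and Partial Differential Equations", Section 8.2. *)
Definition weak_derivative u v := forall phi, C1c phi ->
  \int[mu]_x (u x * derive1 phi x) = - \int[mu]_x (v x * phi x).

(* Every class in H^1(R) has exactly one continuous representative; an element
   of H^1(R) is identified with it, which gives a meaning to u(0) and turns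
   equality in H^1(R) into equality of functions. The weak derivative du is
   determined only almost everywhere. *)
Definition H1_with u du :=
  [/\ continuous u, L2 u, L2 du & weak_derivative u du].

(* At a zero of u the product `|u x| `^ (p - 2) * u x is 0. *)
Definition weak_form p q lambda u du := forall phi dphi, H1_with phi dphi ->
  \int[mu]_x (du x * dphi x)
  + \int[mu]_x (`|u x| `^ (p - 2) * u x * phi x)
  - `|u 0| `^ (q - 2) * u 0 * phi 0
  = - lambda * \int[mu]_x (u x * phi x).

(* u is in H^1(R) and solves (P_lambda). The weak form does not depend on the
   choice of the weak derivative of u. *)
Definition solution p q lambda u :=
  exists2 du, H1_with u du & weak_form p q lambda u du.

Definition nontrivial u := exists x, u x != 0.

Definition positive u := forall x, 0 < u x.

Definition even_fun u := forall x, u (- x) = u x.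

Definition radially_decreasing u := forall x y, `|x| < `|y| -> u y < u x.

Definition nontrivial_solution p q lambda u :=
  solution p q lambda u /\ nontrivial u.

Definition positive_solution p q lambda u :=
  solution p q lambda u /\ positive u.

End defs.

(* Main.v *)
(* With f(u) = |u|^(p-2) u + lambda u and g = |u(0)|^(q-2) u(0), a weak solution
   satisfies int u psi'' = int f(u) psi - g psi(0) for all psi in C^2_c. Hence
   u - U + g x^+, where U'' = f(u), is orthogonal to all second derivatives and
   so is affine: u is C^2 on each closed half-line and satisfies the jump
   condition. On a half-line u'^2 - (2/p) |u|^p - lambda u^2 is constant, and
   square integrability forces the constant to be 0. By Gronwall a nontrivial
   solution never vanishes; lambda >= 0 and, up to sign, u > 0 and
   u' = - u sqrt ((2/p) u^(p-2) + lambda) for x >= 0. The substitution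
   w = u^(-(p-2)/2) gives w' = (p-2)/2 sqrt (2/p + lambda w^2), whose right-hand
   side is Lipschitz and which has explicit solutions. So positive solutions
   are even and correspond to the t = u(0) > 0 with
   2 sqrt ((2/p) t^(p-2) + lambda) = t^(q-2), that is
   lambda = t^(2(q-2)) / 4 - (2/p) t^(p-2), and p < 6 is needed for square
   integrability when lambda = 0. It remains to count these t. *)

Require Import Defs.
From mathcomp Require Import all_boot all_order all_algebra.
From mathcomp Require Import all_classical all_reals all_analysis measurable_realfun.
From mathcomp Require Import ring lra.
Import Order.TTheory GRing.Theory Num.Theory.
Import numFieldNormedType.Exports.
Local Open Scope classical_set_scope.
Local Open Scope ring_scope.

Set Implicit Arguments.
Unset Strict Implicit.
Unset Printing Implicit Defensive.

(** The delicate point of the converse, from profile to weak solution, is that a test function of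
    the weak form is a mere H^1 function, whose weak derivative is known only through C^1_c tests.
    No product rule is used for it: the explicit factor, [u] or its derivative, is truncated away
    from 0 and infinity into a C^1_c function and fed to the definition of the weak derivative. On
    the half-line, square integrability is used only as boundedness of an antiderivative of u^2, so
    the analysis of the orbits compares derivatives and needs no integral. The final count depends
    on the sign of 2 (q - 2) - (p - 2) = 2 (q - (p/2 + 1)), the difference of the exponents of
    t^(2(q-2)) / 4 - (2/p) t^(p-2). If it is positive, this function increases strictly where it is
    positive and takes all positive values. If it is zero, a single power with coefficient 1/4 - 2/p
    remains, positive exactly for p > 8. If it is negative, the function rises and then falls, and
    its maximum is the threshold value of lambda. For lambda = 0 the equation reads t^(2(q-2)-(p-2))
    = 8/p. *)

(** * Derivatives and antiderivatives *)

Section Calculus.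
Context {R : realType}.
Implicit Types (f g df dg F G : R -> R) (a b c x y : R).

Lemma derE f x a b : is_derive x 1 f a -> a = b -> is_derive x 1 f b.
Proof. by move=> + <-. Qed.

Lemma der_ext f g x a : (forall y, f y = g y) -> is_derive x 1 f a ->
  is_derive x 1 g a.
Proof. by move=> /funext ->. Qed.

Lemma derD f g x a b : is_derive x 1 f a -> is_derive x 1 g b ->
  is_derive x 1 (fun y => f y + g y) (a + b).
Proof. exact: is_deriveD. Qed.

Lemma derN f x a : is_derive x 1 f a -> is_derive x 1 (fun y => - f y) (- a).
Proof. exact: is_deriveN. Qed.

Lemma derB f g x a b : is_derive x 1 f a -> is_derive x 1 g b ->
  is_derive x 1 (fun y => f y - g y) (a - b).
Proof. exact: is_deriveB. Qed.

Lemma derM f g x a b : is_derive x 1 f a -> is_derive x 1 g b ->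
  is_derive x 1 (fun y => f y * g y) (a * g x + f x * b).
Proof.
move=> fa gb; have /= := is_deriveM fa gb.
have -> // : f x *: b + g x *: a = a * g x + f x * b.
by rewrite /GRing.scale/=; ring.
Qed.

Lemma derC c x : is_derive x 1 (fun _ : R => c) 0.
Proof. exact: is_derive_cst. Qed.

Lemma derid x : is_derive x 1 (fun y : R => y) 1.
Proof. exact: is_derive_id. Qed.

Lemma derZ c f x a : is_derive x 1 f a -> is_derive x 1 (fun y => c * f y) (c * a).
Proof.
by move=> fa; apply: (derE (derM (derC c x) fa)); ring.
Qed.

Lemma derX n f x a : is_derive x 1 f a ->
  is_derive x 1 (fun y => f y ^+ n) (n%:R * f x ^+ n.-1 * a).
Proof.
move=> fa; elim: n => [|n IH].
  by apply: (derE (derC 1 x)); rewrite !mul0r.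
apply: (der_ext (fun y => esym (exprS (f y) n))); apply: (derE (derM fa IH)).
case: n {IH} => [|n] /=; first by rewrite !expr0; ring.
by rewrite !exprS -[n.+2%:R]natr1; ring.
Qed.

Lemma der_comp f g x a b : is_derive (g x) 1 f a -> is_derive x 1 g b ->
  is_derive x 1 (fun y => f (g y)) (a * b).
Proof. by move=> fa gb; exact: (is_derive1_comp fa gb). Qed.

Lemma der_continuous f x a : is_derive x 1 f a -> {for x, continuous f}.
Proof.
by move=> [fx _]; apply: differentiable_continuous; exact/derivable1_diffP.
Qed.

Lemma der_derive1 f x a : is_derive x 1 f a -> derive1 f x = a.
Proof. by move=> fa; rewrite derive1E derive_val. Qed.

Lemma der_ext_itv f g x y z a : x < y < z -> (forall t, x < t < z -> f t = g t) ->
  is_derive y 1 f a -> is_derive y 1 g a.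
Proof.
move=> /andP[xy yz] fg; apply: near_eq_is_derive.
near=> t; apply: fg; apply/andP; split; near: t.
  exact: lt_nbhsr.
exact: lt_nbhsl.
Unshelve. all: by end_near. Qed.

Lemma der_mvt f df a b : a <= b ->
  (forall x, a <= x <= b -> is_derive x 1 f (df x)) ->
  exists2 c, a <= c <= b & f b - f a = df c * (b - a).
Proof.
move=> ab dfx; have [||c] := @MVT_segment _ f df _ _ ab.
- by move=> x; rewrite in_itv/= => /andP[/ltW ax /ltW xb]; apply: dfx; rewrite ax.
- apply: derivable_within_continuous => x; rewrite in_itv/= => /dfx fx.
  exact: ex_derive.
- by rewrite in_itv/=; exists c.
Qed.

Lemma der_ge0_le f df a b : a <= b ->
  (forall x, a <= x <= b -> is_derive x 1 f (df x)) ->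
  (forall x, a <= x <= b -> 0 <= df x) -> f a <= f b.
Proof.
move=> ab dfx df0; have [c cab e] := der_mvt ab dfx.
by rewrite -subr_ge0 e mulr_ge0 ?df0// subr_ge0.
Qed.

Lemma der_0_cst f a b : a <= b ->
  (forall x, a <= x <= b -> is_derive x 1 f 0) -> f a = f b.
Proof.
move=> ab dfx; have [c cab e] := @der_mvt f (fun=> 0) a b ab dfx.
by apply/esym/eqP; rewrite -subr_eq0 e mul0r.
Qed.

Lemma der_eq f g df a b : a <= b ->
  (forall x, a <= x <= b -> is_derive x 1 f (df x)) ->
  (forall x, a <= x <= b -> is_derive x 1 g (df x)) -> f b - f a = g b - g a.
Proof.
move=> ab fd gd; suff : f a - g a = f b - g b by lra.
apply: (@der_0_cst (fun x => f x - g x)) => // x xab.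
by apply: (derE (derB (fd x xab) (gd x xab))); rewrite subrr.
Qed.

Lemma der_eqT f g df a b :
  (forall x, is_derive x 1 f (df x)) ->
  (forall x, is_derive x 1 g (df x)) -> f b - f a = g b - g a.
Proof.
move=> fd gd; have [ab|/ltW ba] := leP a b; first exact: (der_eq ab).
by have := @der_eq f g df b a ba (fun x _ => fd x) (fun x _ => gd x); lra.
Qed.

Lemma integrable_segment f a b : continuous f ->
  lebesgue_measure.-integrable `[a, b] (EFin \o f).
Proof.
move=> cf; apply: continuous_compact_integrable; first exact: segment_compact.
exact: continuous_subspaceT.
Qed.

Lemma antiderivative f : continuous f ->
  exists F : R -> R, forall x, is_derive x 1 F (f x).
Proof.
move=> cf.
pose I M x := \int[lebesgue_measure]_(t in `[- M, x]) f t.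
have dI M x : - M < x -> is_derive x 1 (I M) (f x).
  move=> Mx.
  have [||d1 d2] := @continuous_FTC1_closed R f (- M) x (x + 1) _ _ Mx (cf x).
    by rewrite ltrDl.
    exact: integrable_segment.
  by rewrite -d2 derive1E; exact: derivableP.
(* Subtracting the value at 0 removes the dependence on the base point [- M], so [M] may vary with
   the point; near [x] the result agrees with the fixed choice [M = |x| + 2]. *)
exists (fun x => I (`|x| + 1) x - I (`|x| + 1) 0) => x.
apply: (@der_ext_itv (fun y => I (`|x| + 2) y - I (`|x| + 2) 0) _
   (- (`|x| + 1)) _ (`|x| + 1)).
- by have := ler_norm x; have := ler_norm (- x); rewrite normrN; lra.
- move=> y yx; have y1 : `|y| < `|x| + 1 by rewrite ltr_norml; lra.
  have y0 := normr_ge0 y.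
  have yy := ler_norm y; have yN := ler_norm (- y); rewrite normrN in yN.
  have [y0'|y0'] := leP 0 y.
    apply: (der_eq y0') => z zy; apply: dI; lra.
  suff : I (`|x| + 2) 0 - I (`|x| + 2) y = I (`|y| + 1) 0 - I (`|y| + 1) y by lra.
  apply: (der_eq (ltW y0')) => z zy; apply: dI; lra.
- apply: (derE (derB (dI _ _ _) (derC _ _)) (subr0 _)).
  by have := ler_norm (- x); rewrite normrN; lra.
Qed.

End Calculus.

(** * Integrals over the line, square integrability and C^1_c functions *)

Section Integrals.
Context {R : realType}.
Implicit Types (f g F : R -> R).
Notation mu := (@lebesgue_measure R).

Lemma integrable_compact_support f (N : R) : continuous f ->
  (forall x, N <= `|x| -> f x = 0) -> mu.-integrable setT (EFin \o f).
Proof.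
move=> cf f0.
have -> : EFin \o f = (EFin \o f) \_ `[- N, N].
  apply/funext => x; rewrite patchE; case: ifPn => //.
  rewrite notin_setE/= in_itv/= => xN; rewrite f0// leNgt; apply/negP => xN'.
  by apply: xN; move: xN'; rewrite ltr_norml => /andP[/ltW-> /ltW->].
apply/integrable_restrict => //.
by rewrite setTI; exact: integrable_segment.
Qed.

Lemma Rintegral_compact_support f F (N : R) : 0 < N -> continuous f ->
  (forall x, N <= `|x| -> f x = 0) -> (forall x : R, is_derive x 1 F (f x)) ->
  \int[mu]_x f x = F N - F (- N).
Proof.
move=> N0 cf f0 dF.
have NN : - N < N by lra.
have -> : \int[mu]_x f x = \int[mu]_(x in `[- N, N]) f x.
  rewrite [RHS]Rintegral_mkcond; apply: eq_Rintegral => x _.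
  rewrite patchE; case: ifPn => //.
  rewrite notin_setE/= in_itv/= => xN; rewrite f0// leNgt; apply/negP => xN'.
  by apply: xN; move: xN'; rewrite ltr_norml => /andP[/ltW-> /ltW->].
have cF x : {for x, continuous F} by apply: der_continuous.
rewrite /Rintegral (@continuous_FTC2 _ f F)//.
- exact: continuous_subspaceT.
- split; first by move=> x _; exact: ex_derive.
  + apply/cvg_at_right_filter; exact: cF.
  + apply/cvg_at_left_filter; exact: cF.
- by move=> x _; exact: der_derive1.
Qed.

Lemma L2P f : L2 f <-> measurable_fun setT f /\
  mu.-integrable setT (EFin \o (fun x => f x ^+ 2)).
Proof.
split=> [l2f|[mf intf]].
  split; last exact: Lfun2_integrable_sqr.
  by move: l2f; rewrite /L2/= inE => /andP[]; rewrite inE.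
rewrite /L2/= inE; apply/andP; split; rewrite inE//=.
rewrite /finite_norm unlock/= poweR_lty//.
move/integrableP : intf => [m2f]; apply: le_lt_trans.
apply: ge0_le_integral => //.
- apply/measurable_EFinP.
  by apply: (measurableT_comp (measurable_powR _)); exact: measurableT_comp.
- exact: measurableT_comp.
- by move=> x _; rewrite lee_fin normrX powR_mulrn.
Qed.

Lemma L2_compact_support f (N : R) : continuous f ->
  (forall x, N <= `|x| -> f x = 0) -> L2 f.
Proof.
move=> cf f0; apply/L2P; split; first exact: continuous_measurable_fun.
apply: (@integrable_compact_support _ N).
  by move=> x; apply: (@continuous_comp _ _ _ f (fun y : R => y ^+ 2));
    [exact: cf|exact: exprn_continuous].
by move=> x /f0 ->; rewrite expr0n.
Qed.

Lemma L2_integrableM f g : L2 f -> L2 g ->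
  mu.-integrable setT (EFin \o (fun x => f x * g x)).
Proof. by move=> l2f l2g; apply/Lfun1_integrable; exact: Lfun2_mul_Lfun1. Qed.

Lemma L2_le f g (C : R) : measurable_fun setT f -> L2 g ->
  (forall x, `|f x| <= C * `|g x|) -> L2 f.
Proof.
move=> mf /L2P[mg ig] fg; apply/L2P; split => //.
have ig' : mu.-integrable setT (EFin \o (fun x => C ^+ 2 * g x ^+ 2)).
  by have := integrableZl measurableT (C ^+ 2) ig.
apply: le_integrable ig' => //.
  by apply/measurable_EFinP; exact: measurable_funX.
move=> x _ /=; rewrite lee_fin -exprMn !normrX ler_sqr ?nnegrE//.
by rewrite normrM; apply: (le_trans (fg x)); rewrite ler_wpM2r// ler_norm.
Qed.

Lemma C1c_support f : C1c f -> exists2 N : R, 0 < N & forall x, N <= `|x| -> f x = 0.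
Proof.
move=> [_ _ /compact_bounded[M [Mr fM]]].
exists (`|M| + 1); first by have := normr_ge0 M; lra.
move=> x Nx; apply/eqP; apply: contraT => fx0.
have /= : `|x| <= `|M| + 2^-1.
  by apply: (fM (`|M| + 2^-1)); [have := ler_norm M; lra|apply: subset_closure].
lra.
Qed.

Lemma C1cI f (df : R -> R) (N : R) : (forall x : R, is_derive x 1 f (df x)) -> continuous df ->
  (forall x, N <= `|x| -> f x = 0) -> C1c f.
Proof.
move=> fd cdf f0.
have f'E : derive1 f = df by apply/funext => x; exact: der_derive1.
split=> [x||]; [exact: ex_derive|by rewrite f'E|].
apply: (@subclosed_compact _ _ `[- N, N]).
- exact: closed_closure.
- exact: segment_compact.
- rewrite [X in _ `<=` X](closure_id _).1; last exact: interval_closed.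
  apply: closureS => x /= fx; rewrite in_itv/= -ler_norml leNgt.
  by apply/negP => /ltW /f0 fx0; rewrite fx0 eqxx in fx.
Qed.

End Integrals.

(** * From the weak form to the differential equation *)

Section Regularity.
Context {R : realType}.
Implicit Types (a b c x y : R).
Notation mu := (@lebesgue_measure R).

(** A nondecreasing [H] with equal end values is constant. At the level of antiderivatives this says
    that a nonnegative function with zero integral vanishes. *)
Lemma der_ge0_eq0 (H h : R -> R) a b :
  (forall x, a <= x <= b -> is_derive x 1 H (h x)) ->
  (forall x, a <= x <= b -> 0 <= h x) -> H a = H b ->
  forall x, a < x < b -> h x = 0.
Proof.
move=> Hd h0 Hab x xab.
have cst y : a < y < b -> H a = H y.
  move=> yab; apply/eqP; rewrite eq_le; apply/andP; split.
    by apply: (@der_ge0_le _ H h) => [|z zab|z zab];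
      [lra|apply: Hd; lra|apply: h0; lra].
  rewrite Hab; apply: (@der_ge0_le _ H h) => [|z zab|z zab];
      [lra|apply: Hd; lra|apply: h0; lra].
have : is_derive x 1 H 0 := der_ext_itv xab cst (derC (H a) x).
have xab' : a <= x <= b by lra.
by move=> /der_derive1 <-; have /der_derive1 := Hd _ xab'.
Qed.

Lemma continuous_plus (f g : R -> R) : continuous f -> continuous g ->
  continuous (fun x => f x + g x).
Proof. by move=> cf cg x; apply: cvgD; [exact: cf|exact: cg]. Qed.

Lemma continuous_mul (f g : R -> R) : continuous f -> continuous g ->
  continuous (fun x => f x * g x).
Proof. by move=> cf cg x; apply: cvgM; [exact: cf|exact: cg]. Qed.

Lemma continuous_opp (f : R -> R) : continuous f -> continuous (fun x => - f x).
Proof. by move=> cf x; apply: cvgN; exact: cf. Qed.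

Lemma continuous_const c : continuous (fun _ : R => c).
Proof. by move=> x; exact: cvg_cst. Qed.

Lemma continuous_id : continuous (fun x : R => x).
Proof. by move=> x; exact: cvg_id. Qed.

Lemma continuous_norm (f : R -> R) : continuous f -> continuous (fun x => `|f x|).
Proof. by move=> cf x; apply: cvg_norm; exact: cf. Qed.

Lemma der_continuousT (f df : R -> R) :
  (forall x : R, is_derive x 1 f (df x)) -> continuous f.
Proof. by move=> fd x; exact: der_continuous. Qed.

(* The test function psi has psi'' = eta := (D - a - b x) w, with w >= 0
   supported in [-N, N] and a, b such that eta has zero moments of order 0 and
   1, so that psi vanishes outside [-N, N]; then int (D - a - b x)^2 w = 0. *)
Lemma orthogonal_second_derivatives_affine (D : R -> R) (N : R) : 0 < N ->
  continuous D ->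
  (forall psi dpsi ddpsi : R -> R,
    (forall x : R, is_derive x 1 psi (dpsi x)) ->
    (forall x : R, is_derive x 1 dpsi (ddpsi x)) ->
    continuous ddpsi -> (forall x, N <= `|x| -> psi x = 0) ->
    \int[mu]_x (D x * ddpsi x) = 0) ->
  exists a b, forall x, `|x| < N -> D x = a + b * x.
Proof.
move=> N0 cD orthD.
pose y (x : R) := N ^+ 2 - x ^+ 2.
pose w (x : R) := (y x + `|y x|) / 2.
have w0 x : 0 <= w x.
  by rewrite /w; have := ler_norm (- y x); rewrite normrN; lra.
have wout x : N <= `|x| -> w x = 0.
  move=> Nx; have yx : y x <= 0.
    by rewrite /y subr_le0 -[x ^+ 2]real_normK ?num_real// ler_pXn2r// nnegrE; lra.
  by rewrite /w ler0_norm//; lra.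
have win x : `|x| < N -> 0 < w x.
  move=> xN; have yx : 0 < y x.
    by rewrite /y subr_gt0 -[x ^+ 2]real_normK ?num_real// ltr_pXn2r// nnegrE; lra.
  by rewrite /w ger0_norm ?ltW//; lra.
have wN x : w (- x) = w x by rewrite /w /y sqrrN.
have cX : continuous (fun x : R => x ^+ 2) by exact: exprn_continuous.
have cy : continuous y.
  by apply: continuous_plus; [exact: continuous_const|exact: continuous_opp].
have cw : continuous w.
  apply: continuous_mul; last exact: continuous_const.
  by apply: continuous_plus => //; exact: continuous_norm.
have [W0 dW0] := antiderivative cw.
have [W1 dW1] := antiderivative (continuous_mul continuous_id cw).
have [W2 dW2] := antiderivative (continuous_mul cX cw).
have [C0 dC0] := antiderivative (continuous_mul cD cw).
have [C1 dC1] := antiderivative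
  (continuous_mul continuous_id (continuous_mul cD cw)).
have NN : - N <= N by lra.
(* The weight is even, so its first moment is 0 and the linear system for [a] and [b] is
   diagonal. *)
have W1N : W1 N = W1 (- N).
  have d x : is_derive x 1 (fun x => W1 (- x)) (x * w x).
    apply: (derE (der_comp (dW1 _) (derN (derid x)))).
    by rewrite wN; ring.
  by have := der_eqT 0 N dW1 d; rewrite oppr0; lra.
have m0 : 0 < W0 N - W0 (- N).
  have := @der_ge0_le _ W0 w _ _ NN (fun x _ => dW0 x) (fun x _ => w0 x).
  rewrite le_eqVlt => /orP[/eqP e|]; last lra.
  have N0N : - N < 0 < N by lra.
  have := der_ge0_eq0 (fun x _ => dW0 x) (fun x _ => w0 x) e N0N.
  by have := win 0; rewrite normr0 => /(_ N0); lra.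
have m2 : 0 < W2 N - W2 (- N).
  have w20 x : 0 <= x ^+ 2 * w x by rewrite mulr_ge0// sqr_ge0.
  have := @der_ge0_le _ W2 _ _ _ NN (fun x _ => dW2 x) (fun x _ => w20 x).
  rewrite le_eqVlt => /orP[/eqP e|]; last lra.
  have N2N : - N < N / 2 < N by lra.
  have := der_ge0_eq0 (fun x _ => dW2 x) (fun x _ => w20 x) e N2N.
  have : 0 < w (N / 2) by apply: win; rewrite ger0_norm; lra.
  have : 0 < (N / 2) ^+ 2 by rewrite exprn_gt0//; lra.
  by move=> h1 h2; have := mulr_gt0 h1 h2; lra.
(* Coefficients of the orthogonal projection of [D] on 1 and [x] for the weight [w]. *)
pose a := (C0 N - C0 (- N)) / (W0 N - W0 (- N)).
pose b := (C1 N - C1 (- N)) / (W2 N - W2 (- N)).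
have aE : a * (W0 N - W0 (- N)) = C0 N - C0 (- N) by rewrite /a divfK// gt_eqF.
have bE : b * (W2 N - W2 (- N)) = C1 N - C1 (- N) by rewrite /b divfK// gt_eqF.
clearbody a b.
pose eta x := (D x - a - b * x) * w x.
pose K := C0 (- N) - a * W0 (- N) - b * W1 (- N).
pose P1 x := C0 x - a * W0 x - b * W1 x - K.
have dP1 x : is_derive x 1 P1 (eta x).
  apply: (derE (derB (derB (derB (dC0 x) (derZ a (dW0 x))) (derZ b (dW1 x)))
     (derC K x))).
  by rewrite /eta; ring.
have [P2' dP2'] := antiderivative (der_continuousT dP1).
pose P2 x := P2' x - P2' (- N).
have dP2 x : is_derive x 1 P2 (P1 x).
  by apply: (derE (derB (dP2' x) (derC _ x))); rewrite subr0.
have P1l : P1 (- N) = 0 by rewrite /P1 /K; ring.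
have P1r : P1 N = 0 by rewrite /P1 /K W1N; lra.
have P2l : P2 (- N) = 0 by rewrite /P2 subrr.
have dxP x : is_derive x 1 (fun x => x * P1 x - P2 x) (x * eta x).
  by apply: (derE (derB (derM (derid x) (dP1 x)) (dP2 x))); ring.
(* [x * P1 x - P2 x] is an antiderivative of [x * eta x], so the vanishing first moment of [eta]
   closes up [P2] at [N]. *)
have P2r : P2 N = 0.
  have d x : is_derive x 1 (fun x => C1 x - a * W1 x - b * W2 x) (x * eta x).
    apply: (derE (derB (derB (dC1 x) (derZ a (dW1 x))) (derZ b (dW2 x)))).
    by rewrite /eta; ring.
  by have := der_eqT (- N) N dxP d; rewrite P1l P1r P2l W1N; lra.
have eta0 x : N <= `|x| -> eta x = 0 by move=> /wout; rewrite /eta => ->; ring.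
have P10 x : N <= `|x| -> P1 x = 0.
  move=> Nx; have [x0|x0] := leP 0 x.
    rewrite ger0_norm// in Nx; rewrite -P1r; apply/esym.
    apply: (der_0_cst Nx) => z zN; rewrite -(eta0 z)//.
    by apply: (le_trans _ (ler_norm z)); lra.
  rewrite ltr0_norm// in Nx; rewrite -P1l.
  apply: der_0_cst; first lra.
  move=> z zN; rewrite -(eta0 z)//.
  by rewrite -normrN; apply: (le_trans _ (ler_norm (- z))); lra.
have P20 x : N <= `|x| -> P2 x = 0.
  move=> Nx; have [x0|x0] := leP 0 x.
    rewrite ger0_norm// in Nx; rewrite -P2r; apply/esym.
    apply: (der_0_cst Nx) => z zN; rewrite -(P10 z)//.
    by apply: (le_trans _ (ler_norm z)); lra.
  rewrite ltr0_norm// in Nx; rewrite -P2l.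
  apply: der_0_cst; first lra.
  move=> z zN; rewrite -(P10 z)//.
  by rewrite -normrN; apply: (le_trans _ (ler_norm (- z))); lra.
have caff : continuous (fun x => D x - a - b * x).
  apply: continuous_plus.
    by apply: continuous_plus => //; exact: continuous_const.
  apply: continuous_opp; apply: continuous_mul; [exact: continuous_const|].
  exact: continuous_id.
have ceta : continuous eta by exact: continuous_mul.
have [E dE] := antiderivative (continuous_mul cD ceta).
have EN : E N = E (- N).
  have := orthD P2 P1 eta dP2 dP1 ceta P20.
  rewrite (Rintegral_compact_support N0 (continuous_mul cD ceta) _ dE); first lra.
  by move=> x /eta0 ->; rewrite mulr0.
(* This antiderivative of the weighted square takes equal values at [- N] and [N]: [E] by the
   orthogonality of [D], the other terms because [P1] and [P2] vanish there. *)
have dQ x : is_derive x 1 (fun x => E x - a * P1 x - b * (x * P1 x - P2 x))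
    ((D x - a - b * x) ^+ 2 * w x).
  apply: (derE (derB (derB (dE x) (derZ a (dP1 x))) (derZ b (dxP x)))).
  by rewrite /eta; ring.
exists a, b => x xN.
have xNN : - N < x < N by move: xN; rewrite ltr_norml.
have q0 z : 0 <= (D z - a - b * z) ^+ 2 * w z by rewrite mulr_ge0// sqr_ge0.
have /= := der_ge0_eq0 (fun x _ => dQ x) (fun x _ => q0 x) _ xNN.
rewrite EN P1l P1r P2l P2r => /(_ _)/eqP.
have wx := win _ xN.
rewrite mulf_eq0 (gt_eqF wx) orbF expf_eq0/=.
by move=> h; have /eqP := h ltac:(by ring); lra.
Qed.

End Regularity.

Section NormPower.
Context {R : realType}.
Implicit Types (r x y : R).

Lemma ler_powR_base r x y : 0 <= r -> 0 <= x -> x <= y -> x `^ r <= y `^ r.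
Proof. by move=> r0 x0 xy; apply: ge0_ler_powR; rewrite ?nnegrE//; lra. Qed.

Lemma ltr_powR_base r x y : 0 < r -> 0 <= x -> x < y -> x `^ r < y `^ r.
Proof. by move=> r0 x0 xy; apply: gt0_ltr_powR; rewrite ?nnegrE//; lra. Qed.

Lemma continuous_normr_powR r : 0 < r -> continuous (fun x => `|x| `^ r).
Proof.
move=> r0 x; have [->|x0] := eqVneq x 0.
  rewrite /continuous_at normr0 powR0 ?gt_eqF//.
  apply/cvgr0Pnorm_lt => e e0.
  near=> y; rewrite ger0_norm ?powR_ge0//.
  have -> : e = (e `^ r^-1) `^ r by rewrite -powRrM mulVf ?gt_eqF// powRr1// ltW.
  apply: ltr_powR_base => //; near: y.
  by apply: (@cvgr0_norm_lt _ _ _ _ _ id); [exact: cvg_id|exact: powR_gt0].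
apply: (@continuous_comp _ _ _ (fun y : R => `|y|) (fun y : R => y `^ r)).
  exact: norm_continuous.
by apply: der_continuous; apply: is_derive1_powR; rewrite normr_gt0.
Unshelve. all: by end_near. Qed.

End NormPower.

Section Classical.
Context {R : realType}.
Implicit Types (x y p q lambda : R).
Notation mu := (@lebesgue_measure R).

Definition nonlin p lambda x := `|x| `^ (p - 2) * x + lambda * x.

Lemma continuous_nonlin p lambda (u : R -> R) : 2 < p -> continuous u ->
  continuous (fun x => nonlin p lambda (u x)).
Proof.
move=> p2 cu; apply: continuous_plus; apply: continuous_mul => //.
  move=> x; apply: (@continuous_comp _ _ _ u (fun y => `|y| `^ (p - 2))).
    exact: cu.
  by apply: continuous_normr_powR; lra.
exact: continuous_const.
Qed.

Lemma integrable_mul_compact_support (f g : R -> R) (N : R) : continuous f -> continuous g ->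
  (forall x, N <= `|x| -> g x = 0) ->
  mu.-integrable setT (EFin \o (fun x => f x * g x)).
Proof.
move=> cf cg g0; apply: (@integrable_compact_support _ _ N).
  exact: continuous_mul.
by move=> x /g0 ->; rewrite mulr0.
Qed.

(** The margin 1 leaves an open interval around [x] on which [f] vanishes, as a two-sided derivative
    requires. *)
Lemma der_support (f df : R -> R) (N : R) : (forall x : R, is_derive x 1 f (df x)) ->
  (forall x, N <= `|x| -> f x = 0) -> forall x, N + 1 <= `|x| -> df x = 0.
Proof.
move=> fd f0 x Nx.
have [a ax [b bx fab]] : exists2 a, a < x & exists2 b, x < b &
    forall y, a < y < b -> 0 = f y.
  have [x0|x0] := leP 0 x.
    rewrite ger0_norm// in Nx; exists N; [lra|exists (x + 1); [lra|]].
    by move=> y yab; rewrite f0//; apply: (le_trans _ (ler_norm _)); lra.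
  rewrite ltr0_norm// in Nx; exists (x - 1); [lra|exists (- N); [lra|]].
  move=> y yab; rewrite f0// -normrN; apply: (le_trans _ (ler_norm _)); lra.
have axb : a < x < b by apply/andP.
have /der_derive1 <- := der_ext_itv axb fab (derC 0 x).
by have /der_derive1 -> := fd x.
Qed.

Lemma C1c_H1 (f df : R -> R) (N : R) : (forall x : R, is_derive x 1 f (df x)) ->
  continuous df -> (forall x, N <= `|x| -> f x = 0) -> H1_with f df.
Proof.
move=> fd cdf f0; have cf := der_continuousT fd.
split=> //.
- exact: L2_compact_support f0.
- exact: L2_compact_support cdf (der_support fd f0).
move=> phi [dphi cphi' _].
have phid (x : R) : is_derive x 1 phi (derive1 phi x).
  by rewrite derive1E; apply: derivableP; exact: dphi.
have cphi := der_continuousT phid.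
pose M := `|N| + 1.
have M0 : 0 < M by rewrite /M; have := normr_ge0 N; lra.
have f0M x : M <= `|x| -> f x = 0.
  by move=> Mx; apply: f0; rewrite /M in Mx; have := ler_norm N; lra.
have df0M x : M <= `|x| -> df x = 0.
  move=> Mx; apply: (der_support fd f0).
  by rewrite /M in Mx; have := ler_norm N; lra.
apply/eqP; rewrite -addr_eq0; apply/eqP.
rewrite -RintegralD//.
- have dF (x : R) : is_derive x 1 (fun x => f x * phi x)
      (f x * derive1 phi x + df x * phi x).
    by apply: (derE (derM (fd x) (phid x))); ring.
  apply: (etrans (Rintegral_compact_support M0 _ _ dF)).
  + by apply: continuous_plus; exact: continuous_mul.
  + by move=> x Mx; rewrite f0M// df0M//; ring.
  + rewrite !f0M ?normrN ?(ger0_norm (ltW M0))//; ring.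
- apply: (@integrable_compact_support _ _ M); first exact: continuous_mul.
  by move=> x Mx; rewrite f0M// mul0r.
- apply: (@integrable_compact_support _ _ M); first exact: continuous_mul.
  by move=> x Mx; rewrite df0M// mul0r.
Qed.

(** [ur] and [ul] extend the right half of [u] and the reflected left half to the whole line, so
    that one-sided derivatives at 0 become ordinary ones: [vr 0] is the right derivative of [u] and
    [vl 0] is minus the left one. Beyond 0 their second derivatives are still computed from [u]. *)
Lemma solution_classical p q lambda (u : R -> R) : 2 < p ->
  solution p q lambda u -> exists ur vr ul vl : R -> R,
  [/\ (forall x : R, is_derive x 1 ur (vr x)),
      (forall x : R, is_derive x 1 vr (nonlin p lambda (u x))),
      (forall x, 0 <= x -> u x = ur x),
      (forall x : R, is_derive x 1 ul (vl x)) &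
      [/\ (forall x : R, is_derive x 1 vl (nonlin p lambda (u (- x)))),
      (forall x, 0 <= x -> u (- x) = ul x) &
      vr 0 + vl 0 = - (`|u 0| `^ (q - 2) * u 0)]].
Proof.
move=> p2 [du [cu l2u l2du wdu] wf].
set g := _ * u 0.
have cfu := @continuous_nonlin p lambda u p2 cu.
have [F dF] := antiderivative cfu.
have [U dU] := antiderivative (der_continuousT dF).
pose pos x := (x + `|x|) / 2.
have cpos : continuous pos.
  apply: continuous_mul; last exact: continuous_const.
  apply: continuous_plus; first exact: continuous_id.
  by apply: continuous_norm; exact: continuous_id.
pose D x := u x - U x + g * pos x.
have cU := der_continuousT dU.
have cD : continuous D.
  apply: continuous_plus.
    by apply: continuous_plus => //; exact: continuous_opp.
  by apply: continuous_mul => //; exact: continuous_const.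
have orthD N : 0 < N -> forall psi dpsi ddpsi : R -> R,
    (forall x : R, is_derive x 1 psi (dpsi x)) ->
    (forall x : R, is_derive x 1 dpsi (ddpsi x)) ->
    continuous ddpsi -> (forall x, N <= `|x| -> psi x = 0) ->
    \int[mu]_x (D x * ddpsi x) = 0.
  move=> N0 psi dpsi ddpsi psid dpsid cdd psi0.
  have cd := der_continuousT dpsid.
  have c := der_continuousT psid.
  have dpsi0 := der_support psid psi0.
  have ddpsi0 := der_support dpsid dpsi0.
  have [M [M0 ddpsi0M psi0M dpsi0M]] : exists M : R, [/\ 0 < M,
      (forall x, M <= `|x| -> ddpsi x = 0), (forall x, M <= `|x| -> psi x = 0) &
      (forall x, M <= `|x| -> dpsi x = 0)].
    exists (N + 1 + 1); split=> [|//|x Mx|x Mx]; first lra.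
      by apply: psi0; lra.
    by apply: dpsi0; lra.
  have nM : `|M| = M by rewrite gtr0_norm.
  (* The second derivative of [pos] is the Dirac mass at 0: on the right half-line
     [x * dpsi x - psi x] is an antiderivative, and only its value at 0 contributes. *)
  have e5 : \int[mu]_x (pos x * ddpsi x) = psi 0.
    have cpd := continuous_mul cpos cdd.
    have [A dA] := antiderivative cpd.
    rewrite (Rintegral_compact_support M0 cpd _ dA); last first.
      by move=> x /ddpsi0M ->; rewrite mulr0.
    have -> : A (- M) = A 0.
      have MN : - M <= 0 by lra.
      apply: (der_0_cst MN) => x x0.
      apply: (derE (dA x)); rewrite /pos ler0_norm; last lra.
      by rewrite subrr !mul0r.
    have dB (x : R) : is_derive x 1 (fun x => x * dpsi x - psi x) (x * ddpsi x).
      by apply: (derE (derB (derM (derid x) (dpsid x)) (psid x))); ring.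
    apply: (etrans (der_eq (ltW M0) _ (fun x _ => dB x))).
      by move=> x x0; apply: (derE (dA x)); rewrite /pos ger0_norm; [field|lra].
    by rewrite dpsi0M ?nM// psi0M ?nM//; ring.
  have dd' : derive1 dpsi = ddpsi by apply/funext => x; exact: der_derive1.
  have e1 := wdu dpsi (C1cI dpsid cdd dpsi0); rewrite dd' in e1.
  have e2 := wf psi dpsi (C1c_H1 psid cd psi0).
  have cpow : continuous (fun x => `|u x| `^ (p - 2) * u x).
    apply: continuous_mul => // x.
    apply: (@continuous_comp _ _ _ u (fun y => `|y| `^ (p - 2))); first exact: cu.
    by apply: continuous_normr_powR; lra.
  have e3 : \int[mu]_x (nonlin p lambda (u x) * psi x) =
      \int[mu]_x (`|u x| `^ (p - 2) * u x * psi x) + lambda * \int[mu]_x (u x * psi x).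
    rewrite -RintegralZl//; last exact: integrable_mul_compact_support psi0.
    rewrite -RintegralD//; last 2 first.
    - exact: (integrable_mul_compact_support cpow c psi0).
    - apply: (@integrable_compact_support _ _ N).
        by apply: continuous_mul; [exact: continuous_const|exact: continuous_mul].
      by move=> x /psi0 ->; rewrite !mulr0.
    by apply: eq_Rintegral => x _; rewrite /nonlin; ring.
  have e4 : \int[mu]_x (U x * ddpsi x - nonlin p lambda (u x) * psi x) = 0.
    have dG (x : R) : is_derive x 1 (fun x => U x * dpsi x - F x * psi x)
        (U x * ddpsi x - nonlin p lambda (u x) * psi x).
      apply: (derE (derB (derM (dU x) (dpsid x)) (derM (dF x) (psid x)))).
      by ring.
    apply: (etrans (Rintegral_compact_support M0 _ _ dG)).
    - apply: continuous_plus; first exact: continuous_mul.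
      by apply: continuous_opp; exact: continuous_mul.
    - by move=> x Mx; rewrite ddpsi0M// psi0M//; ring.
    - by rewrite !dpsi0M ?normrN ?nM// !psi0M ?normrN ?nM//; ring.
  rewrite RintegralB// in e4; last 2 first.
  - exact: integrable_mul_compact_support ddpsi0M.
  - exact: integrable_mul_compact_support psi0.
  have e6 : \int[mu]_x (D x * ddpsi x) = \int[mu]_x (u x * ddpsi x) -
     \int[mu]_x (U x * ddpsi x) + g * \int[mu]_x (pos x * ddpsi x).
    rewrite -RintegralZl//; last exact: integrable_mul_compact_support ddpsi0M.
    rewrite -RintegralB//; [|exact: integrable_mul_compact_support ddpsi0M..].
    rewrite -RintegralD//; last 2 first.
    - apply: (@integrable_compact_support _ _ M).
        apply: continuous_plus; first exact: continuous_mul.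
        by apply: continuous_opp; exact: continuous_mul.
      by move=> x /ddpsi0M ->; ring.
    - apply: (@integrable_compact_support _ _ M).
        by apply: continuous_mul; [exact: continuous_const|exact: continuous_mul].
      by move=> x /ddpsi0M ->; ring.
    by apply: eq_Rintegral => x _; rewrite /D; ring.
  rewrite e6 e5; move: e1 e2 e3 e4; rewrite -/g.
  set i1 := \int[mu]_x (u x * ddpsi x).
  set i2 := \int[mu]_x (du x * dpsi x).
  set i3 := \int[mu]_x (`|u x| `^ (p - 2) * u x * psi x).
  set i4 := \int[mu]_x (u x * psi x).
  set i5 := \int[mu]_x (nonlin p lambda (u x) * psi x).
  set i6 := \int[mu]_x (U x * ddpsi x).
  move=> e1 e2 e3 e4; lra.
(* The affine function is found on an interval that depends on [x], but the radius [|x| + 2]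
   includes 0 and 1, whose values fix the coefficients once for all. *)
have Daff x : D x = D 0 + (D 1 - D 0) * x.
  have N0 : 0 < `|x| + 2 by have := normr_ge0 x; lra.
  have [a [b ab]] := orthogonal_second_derivatives_affine N0 cD (orthD _ N0).
  have D0 : D 0 = a + b * 0 by apply: ab; rewrite normr0.
  have D1 : D 1 = a + b * 1.
    by apply: ab; rewrite normr1; have := normr_ge0 x; lra.
  by rewrite D0 D1 ab; [ring|lra].
pose k := D 1 - D 0.
have uE x : u x = U x - g * pos x + D 0 + k * x.
  by have := Daff x; rewrite {1}/D /k; lra.
exists (fun x => U x + D 0 + (k - g) * x), (fun x => F x + (k - g)),
  (fun x => U (- x) + D 0 - k * x), (fun x => - F (- x) - k); split.
- move=> x; apply: (derE (derD (derD (dU x) (derC _ _)) (derZ _ (derid x)))).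
  by ring.
- by move=> x; apply: (derE (derD (dF x) (derC _ _))); ring.
- by move=> x x0; rewrite uE /pos ger0_norm//; field.
- move=> x; apply: (derE (derB (derD (der_comp (dU _) (derN (derid x)))
    (derC _ _)) (derZ _ (derid x)))).
  by ring.
split.
- move=> x; apply: (derE (derB (derN (der_comp (dF _) (derN (derid x)))) (derC _ _))).
  by ring.
- by move=> x x0; rewrite uE /pos normrN ger0_norm//; field.
- by rewrite oppr0; ring.
Qed.

End Classical.

(** * The equation on a half-line *)

Section HalfLine.
Context {R : realType}.
Implicit Types (x y p q lambda : R).

(** This is the derivative of |y|^p, in the form that occurs in the energy. *)
Lemma der_normr_powR_sqr p x : 2 < p ->
  is_derive x 1 (fun y => `|y| `^ (p - 2) * y ^+ 2) (p * (`|x| `^ (p - 2) * x)).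
Proof.
move=> p2.
have pE (y : R) : y != 0 -> p = p - 2 + 2 by move=> _; ring.
case: (ltgtP x 0) => [x0|x0|->].
- apply: (@der_ext_itv _ (fun y => (- y) `^ p) _ (x - 1) x 0); first lra.
    move=> y /andP[_ y0]; rewrite ltr0_norm// {1}(pE _ (ltr0_neq0 y0)).
    rewrite powRD ?powR_mulrn ?sqrrN//; first lra.
    by rewrite oppr_eq0 (lt_eqF y0) implybT.
  have Nx0 : 0 < - x by lra.
  apply: (derE (der_comp (is_derive1_powR p Nx0) (derN (derid x)))).
  rewrite ltr0_norm//.
  have -> : p - 1 = p - 2 + 1 by ring.
  rewrite powRD ?powRr1; [ring|lra|].
  by rewrite oppr_eq0 (lt_eqF x0) implybT.
- apply: (@der_ext_itv _ (fun y => y `^ p) _ 0 x (x + 1)); first lra.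
    move=> y /andP[y0 _]; rewrite gtr0_norm// {1}(pE _ (lt0r_neq0 y0)).
    rewrite powRD ?powR_mulrn//; first lra.
    by rewrite (gt_eqF y0) implybT.
  apply: (derE (is_derive1_powR p x0)).
  rewrite gtr0_norm//.
  have -> : p - 1 = p - 2 + 1 by ring.
  rewrite powRD ?powRr1; [ring|lra|].
  by rewrite (gt_eqF x0) implybT.
(* At 0 the difference quotient is |y|^(p-2) y, continuous because p > 2. *)
- apply/is_derive1_caratheodory; exists (fun y => `|y| `^ (p - 2) * y); split.
  + by move=> z; rewrite normr0; ring.
  + by apply: continuous_mul; [apply: continuous_normr_powR; lra|exact: continuous_id].
  + by ring.
Qed.

Lemma two_div_itv p : 2 < p -> 0 < 2 / p < 1.
Proof.
by move=> p2; apply/andP; split; [rewrite divr_gt0|rewrite ltr_pdivrMr]; lra.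
Qed.

Lemma der_expRM (c : R) x : is_derive x 1 (fun y => expR (c * y)) (c * expR (c * x)).
Proof.
apply: (derE (der_comp (is_derive_expR (c * x)) (derZ c (derid x)))).
by ring.
Qed.

(** From 2 z y <= z^2 + y^2 <= (1 + K) z^2, the function z^2 exp (- (1 + K) x) is nonincreasing. The
    squared hypothesis is the form in which the energy identity and the Lipschitz bound below
    arrive. *)
Lemma gronwall_forward (z y : R -> R) (b K : R) : 0 <= b ->
  (forall x, 0 <= x <= b -> is_derive x 1 z (y x)) ->
  (forall x, 0 <= x <= b -> y x ^+ 2 <= K * z x ^+ 2) ->
  z 0 = 0 -> z b = 0.
Proof.
move=> b0 dz yz z0; pose c := - (1 + K).
have le := @der_ge0_le _ (fun x => - (z x ^+ 2 * expR (c * x)))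
  (fun x => - ((2 * z x * y x + c * z x ^+ 2) * expR (c * x))) _ _ b0.
have : - (z 0 ^+ 2 * expR (c * 0)) <= - (z b ^+ 2 * expR (c * b)).
  apply: le => x xb.
    apply: (derE (derN (derM (derX 2 (dz x xb)) (der_expRM c x)))).
    by rewrite /= expr1; ring.
  rewrite oppr_ge0 pmulr_lle0 ?expR_gt0// /c.
  by have := yz x xb; have := sqr_ge0 (z x - y x); nra.
rewrite z0 expr0n/= mul0r oppr0 oppr_ge0 pmulr_lle0 ?expR_gt0// => zb.
by apply/eqP; rewrite -sqrf_eq0 eq_le zb sqr_ge0.
Qed.

Lemma gronwall_backward (z y : R -> R) (b K : R) : 0 <= b ->
  (forall x, 0 <= x <= b -> is_derive x 1 z (y x)) ->
  (forall x, 0 <= x <= b -> y x ^+ 2 <= K * z x ^+ 2) ->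
  z b = 0 -> z 0 = 0.
Proof.
move=> b0 dz yz zb.
have := @gronwall_forward (fun x => z (b - x)) (fun x => - y (b - x)) b K b0.
rewrite subrr; apply.
- move=> x xb; have xb' : 0 <= b - x <= b by lra.
  apply: (derE (@der_comp _ z (fun t => b - t) x _ _ (dz _ xb')
    (derB (derC b x) (derid x)))).
  by ring.
- by move=> x xb; rewrite sqrrN; apply: yz; lra.
- by rewrite subr0.
Qed.

Section Orbit.
(* [P] is an antiderivative of [u ^+ 2]: its boundedness encodes that [u] is
   square integrable on the half-line. *)
Variables (p lambda : R) (u v P : R -> R) (C : R).
Hypothesis p2 : 2 < p.
Hypothesis du : forall x, 0 <= x -> is_derive x 1 u (v x).
Hypothesis dv : forall x, 0 <= x -> is_derive x 1 v (nonlin p lambda (u x)).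
Hypothesis dP : forall x, 0 <= x -> is_derive x 1 P (u x ^+ 2).
Hypothesis PC : forall x, 0 <= x -> P x <= C.

Let A x := `|u x| `^ (p - 2) * u x ^+ 2.

Let A0 x : 0 <= A x. Proof. by rewrite mulr_ge0 ?powR_ge0 ?sqr_ge0. Qed.

(** Square integrability enters the study of orbits through this contradiction: [P] would grow at
    least linearly. At the chosen [b] it would be at least [C + d]. *)
Lemma sqr_not_bounded_below (d M : R) : 0 < d -> 0 <= M ->
  (forall x, M <= x -> d <= u x ^+ 2) -> False.
Proof.
move=> d0 M0 ud; pose b := M + (C - P M) / d + 1.
have PM := PC M0.
have Mb : M + 1 <= b.
  by rewrite /b; have := divr_ge0 (_ : 0 <= C - P M) (ltW d0); lra.
have Mb' : M <= b by lra.
have := @der_ge0_le _ (fun x => P x - d * x) (fun x => u x ^+ 2 - d) _ _ Mb'.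
have -> : P b - d * b = P b - d * M - (C - P M) - d.
  by rewrite /b; field; rewrite gt_eqF.
have := PC (_ : 0 <= b) => /(_ ltac:(lra)) => h1 h2.
have : P M - d * M <= P b - d * M - (C - P M) - d.
  apply: h2 => x xM.
    apply: (derE (derB (dP _) (derZ d (derid x)))); [lra|ring].
  by have := ud x; lra.
lra.
Qed.

(* If the energy is positive, (u v)' >= E - C u^2 makes u v, hence u^2, large;
   if it is negative, u^2 is bounded below. Both contradict the bound on P. *)
Lemma energy_zero x : 0 <= x -> v x ^+ 2 = 2 / p * A x + lambda * u x ^+ 2.
Proof.
move=> x0.
have p2' := p2; have p0 := two_div_itv p2.
pose E x := v x ^+ 2 - (2 / p * A x + lambda * u x ^+ 2).
have dE y : 0 <= y -> is_derive y 1 E 0.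
  move=> y0; have dA := der_comp (der_normr_powR_sqr (u y) p2) (du y0).
  apply: (derE (derB (derX 2 (dv y0)) (derD (derZ (2 / p) dA)
    (derZ lambda (derX 2 (du y0)))))).
  by rewrite /= !expr1 /nonlin; field; lra.
have EE y : 0 <= y -> E y = E 0.
  by move=> y0; apply/esym/der_0_cst => // z /andP[z0 _]; exact: dE.
suff : E 0 = 0 by move=> E0; have := EE x x0; rewrite {1}/E E0; lra.
case: (ltgtP (E 0) 0) => // [En|Ep].
(* When u^2 < 1 one has A <= u^2, and v^2 >= 0 turns the conservation of [E] into - E 0 <= (1 +
   |lambda|) u^2. *)
- pose d := Num.min 1 (- E 0 / (1 + `|lambda|)).
  have l0 := normr_ge0 lambda.
  have d0 : 0 < d by rewrite lt_min ltr01 divr_gt0//; lra.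
  exfalso; apply: (sqr_not_bounded_below d0 (lexx 0)) => y y0.
  have [u1|u1] := leP 1 (u y ^+ 2); first by rewrite ge_min u1.
  rewrite ge_min; apply/orP; right; rewrite ler_pdivrMr; last lra.
  have nu1 : `|u y| <= 1.
    by rewrite -(@expr_le1 _ 2)// real_normK ?num_real// ltW.
  have Au : A y <= u y ^+ 2.
    rewrite /A ler_piMl ?sqr_ge0//.
    have pp : 0 <= p - 2 by lra.
    by have := ler_powR_base pp (normr_ge0 (u y)) nu1; rewrite powR1.
  have := EE y y0; rewrite {1}/E.
  have := sqr_ge0 (v y); have := A0 y; have := ler_norm lambda.
  have u20 := sqr_ge0 (u y).
  move: (u y ^+ 2) (A y) (v y ^+ 2) Au u20 => U2 Ay V2 Au u20 ll Ay0 V20 e.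
  have h1 : 2 / p * Ay <= U2 by nra.
  have h2 : lambda * U2 <= `|lambda| * U2 by rewrite ler_wpM2r.
  by nra.
(* The factor 2 arises because [lambda * u ^+ 2] occurs both in v^2, through the energy, and in u
   f(u). *)
- pose c : R := 2 * `|lambda|.
  have l0 := normr_ge0 lambda.
  have c0 : 0 <= c by rewrite mulr_ge0.
  pose C' := - (u 0 * v 0) - c * P 0 + c * C.
  have low y : 0 <= y -> E 0 * y - C' <= u y * v y.
    move=> y0.
    have := @der_ge0_le _ (fun x => u x * v x + c * P x - E 0 * x)
       (fun x => v x ^+ 2 + u x * nonlin p lambda (u x) + c * u x ^+ 2 - E 0) _ _ y0.
    have -> : u 0 * v 0 + c * P 0 - E 0 * 0 = - C' + c * C by rewrite /C'; ring.
    have : c * P y <= c * C by rewrite ler_wpM2l// PC.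
    move=> h1 h2; suff : - C' + c * C <= u y * v y + c * P y - E 0 * y by lra.
    apply: h2 => z /andP[z0 _].
      apply: (derE (derB (derD (derM (du z0) (dv z0)) (derZ c (dP z0)))
        (derZ (E 0) (derid z)))).
      by ring.
    have := EE z z0; rewrite {1}/E => e.
    have -> : u z * nonlin p lambda (u z) = A z + lambda * u z ^+ 2.
      by rewrite /nonlin /A; ring.
    have := A0 z; have := sqr_ge0 (u z); have := ler_norm (- lambda).
    rewrite normrN /c.
    move: e; move: (u z ^+ 2) (A z) (v z ^+ 2) => U2 Az V2 e h3 h4 h5.
    have h6 : - lambda * U2 <= `|lambda| * U2 by rewrite ler_wpM2r.
    have h7 : 0 <= 2 / p * Az by rewrite mulr_ge0//; lra.
    by nra.
  pose M : R := (`|C'| + 1) / E 0.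
  have M0 : 0 <= M.
    by rewrite /M divr_ge0 ?(ltW Ep)//; have := normr_ge0 C'; lra.
  have uv1 y : M <= y -> 1 <= u y * v y.
    move=> My; have := low y (le_trans M0 My); have := ler_norm C'.
    have : E 0 * M <= E 0 * y by rewrite ler_wpM2l// ltW.
    rewrite /M [E 0 * _]mulrC divfK ?gt_eqF//; lra.
  exfalso; apply: (@sqr_not_bounded_below 2 (M + 1)) => // [|y My]; first lra.
  have My' : M <= y by lra.
  (* Past [M] the derivative 2 u v of u^2 is at least 2, so u^2 >= 2 from [M + 1] on. *)
  have := @der_ge0_le _ (fun x => u x ^+ 2 - 2 * x) (fun x => 2 * (u x * v x - 1)) _ _ My'.
  have := sqr_ge0 (u M) => h1 h2.
  suff : u M ^+ 2 - 2 * M <= u y ^+ 2 - 2 * y by lra.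
  apply: h2 => z zM.
    have z0 : 0 <= z by lra.
    apply: (derE (derB (derX 2 (du z0)) (derZ 2 (derid z)))).
    by rewrite /= expr1; ring.
  by have := uv1 z; lra.
Qed.

Let within_u (f df : R -> R) (a b : R) : (forall x, 0 <= x -> is_derive x 1 f (df x)) ->
  0 <= a -> {within `[a, b], continuous f}.
Proof.
move=> fd a0; apply: derivable_within_continuous => x.
rewrite in_itv/= => /andP[ax _]; apply: ex_derive.
exact: fd (le_trans a0 ax).
Qed.

(** At zero energy, the bound of [u] on a segment makes v^2 at most a multiple of u^2, so Gronwall
    applies to [u] alone and transports a zero of [u] in either direction. *)
Let v_le (b : R) : 0 <= b -> exists K : R, forall x, 0 <= x <= b -> v x ^+ 2 <= K * u x ^+ 2.
Proof.
move=> b0.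
have p2' := p2; have p0 := two_div_itv p2.
have /compact_bounded[B [_ uB]] :=
  continuous_compact (@within_u u v 0 b du (lexx 0)) (@segment_compact R 0 b).
pose B1 : R := `|B| + 1.
have B1u x : 0 <= x <= b -> `|u x| <= B1.
  move=> xb; apply: uB; first by rewrite /B1; have := ler_norm B; lra.
  by exists x => //=; rewrite in_itv.
exists (B1 `^ (p - 2) + lambda) => x xb.
rewrite energy_zero; last by case/andP: xb.
rewrite mulrDl.
suff : 2 / p * A x <= B1 `^ (p - 2) * u x ^+ 2 by lra.
have : A x <= B1 `^ (p - 2) * u x ^+ 2.
  by rewrite ler_wpM2r ?sqr_ge0//; apply: ler_powR_base; [lra|exact: normr_ge0|exact: B1u].
by have := A0 x; nra.
Qed.

Lemma orbit_zero : u 0 = 0 -> forall x, 0 <= x -> u x = 0.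
Proof.
move=> u0 x x0; have [K vK] := v_le x0.
apply: (gronwall_forward x0 _ vK u0) => y /andP[y0 _]; exact: du.
Qed.

Lemma orbit_gt0 : 0 < u 0 -> forall x, 0 <= x -> 0 < u x.
Proof.
move=> u0 x x0; rewrite ltNge; apply/negP => ux.
have [|c /[!in_itv]/= /andP[c0 _] uc] := @IVT _ u 0 x 0 x0 (@within_u u v 0 x du (lexx 0)).
  by rewrite ge_min ux le_max (ltW u0) orbT.
have [K vK] := v_le c0.
suff : u 0 = 0 by lra.
apply: (gronwall_backward c0 _ vK uc) => y /andP[y0 _]; exact: du.
Qed.

Lemma orbit_profile : 0 < u 0 -> 0 <= lambda /\ forall x, 0 <= x ->
  v x = - (u x * Num.sqrt (2 / p * u x `^ (p - 2) + lambda)).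
Proof.
move=> u0; have up := orbit_gt0 u0.
have p2' := p2; have p0 := two_div_itv p2.
have v2 x : 0 <= x -> v x ^+ 2 = u x ^+ 2 * (2 / p * u x `^ (p - 2) + lambda).
  by move=> x0; rewrite energy_zero// /A gtr0_norm ?up//; ring.
(* For negative [lambda], v^2 >= 0 and 2/p < 1 would force u^(p-2) >= - lambda, a positive lower
   bound for [u]. *)
have l0 : 0 <= lambda.
  rewrite leNgt; apply/negP => l0.
  have pp : 0 < p - 2 by lra.
  have d0 : 0 < ((- lambda) `^ (p - 2)^-1) ^+ 2.
    by rewrite exprn_gt0// powR_gt0//; lra.
  apply: (sqr_not_bounded_below d0 (lexx 0)) => x x0.
  rewrite ler_sqr ?nnegrE ?powR_ge0 ?(ltW (up _ x0))//.
  rewrite leNgt; apply/negP => /(ltr_powR_base pp (ltW (up _ x0))).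
  rewrite -powRrM mulVf ?gt_eqF// powRr1; last lra.
  have := v2 x x0; have := sqr_ge0 (v x) => h1 h2 h3.
  move: h1; rewrite h2 pmulr_rge0 ?exprn_gt0 ?up//.
  have := powR_ge0 (u x) (p - 2); nra.
split=> // x x0.
have G0 y : 0 <= y -> 0 < 2 / p * u y `^ (p - 2) + lambda.
  by move=> y0; rewrite ltr_wpDr// mulr_gt0 ?powR_gt0 ?up//; lra.
have vn0 y : 0 <= y -> v y != 0.
  move=> y0; rewrite -sqrf_eq0 v2// mulf_neq0 ?gt_eqF ?G0//.
  by rewrite exprn_gt0 ?up.
(* As [v] never vanishes, one positive value would make it positive from there on; [u] would be
   nondecreasing and stay away from 0. *)
have vneg y : 0 <= y -> v y < 0.
  move=> y0; rewrite lt_neqAle vn0//= leNgt; apply/negP => vy.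
  have vpos z : y <= z -> 0 <= v z.
    move=> yz; rewrite leNgt; apply/negP => vz.
    have [|c /[!in_itv]/= /andP[c0 _] vc] := @IVT _ v y z 0 yz
      (@within_u v (fun x => nonlin p lambda (u x)) y z dv y0).
      by rewrite ge_min (ltW vz) le_max (ltW vy) orbT.
    by have := vn0 c (le_trans y0 c0); rewrite vc eqxx.
  have d0 : 0 < u y ^+ 2 by rewrite exprn_gt0 ?up.
  apply: (sqr_not_bounded_below d0 y0) => z yz.
  rewrite ler_sqr ?nnegrE ?(ltW (up _ _))//; last exact: le_trans yz.
  apply: (der_ge0_le yz) => t yt; [apply: du; lra|apply: vpos; lra].
apply: oppr_inj; rewrite opprK.
have vx := vneg x x0.
rewrite -[LHS](@ger0_norm _ (- v x)) ?oppr_ge0 ?ltW// -sqrtr_sqr sqrrN v2//.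
by rewrite sqrtrM ?sqr_ge0// sqrtr_sqr gtr0_norm ?up.
Qed.

End Orbit.

(** * The first-order equation of positive orbits *)

Definition profile p lambda (U : R -> R) := forall x, 0 <= x ->
  0 < U x /\ is_derive x 1 U (- (U x * Num.sqrt (2 / p * U x `^ (p - 2) + lambda))).

Lemma profile_linearized p lambda (U : R -> R) x : 2 < p -> profile p lambda U ->
  0 <= x -> let k := (p - 2) / 2 in
  is_derive x 1 (fun y => U y `^ (- k))
    (k * Num.sqrt (2 / p + lambda * (U x `^ (- k)) ^+ 2)).
Proof.
move=> p2 pU x0 k; have [Ux dU] := pU x x0.
apply: (derE (der_comp (is_derive1_powR (- k) Ux) dU)).
have wx : 0 < U x `^ (- k) by exact: powR_gt0.
have w1 : U x `^ (- k - 1) * U x = U x `^ (- k).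
  rewrite -{2}(powRr1 (ltW Ux)) -powRD ?(gt_eqF Ux) ?implybT//.
  by congr (_ `^ _); ring.
(* This relation dictates the exponent [- k]: it turns the power under the root into the constant
   [2 / p]. *)
have w2 : (U x `^ (- k)) ^+ 2 * U x `^ (p - 2) = 1.
  rewrite -powR_mulrn ?powR_ge0// -powRrM -powRD ?(gt_eqF Ux) ?implybT//.
  by rewrite (_ : _ + _ = 0) ?powRr0// /k; field.
transitivity (k * (U x `^ (- k) * Num.sqrt (2 / p * U x `^ (p - 2) + lambda))).
  by rewrite -w1; ring.
congr (_ * _); rewrite -{1}(ger0_norm (ltW wx)) -sqrtr_sqr -sqrtrM ?sqr_ge0//.
by congr Num.sqrt; rewrite mulrDr mulrCA w2; ring.
Qed.

(** The root is the Euclidean norm of the vector (sqrt a, sqrt l x), so this is the reverse triangle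
    inequality; [cs] is Cauchy-Schwarz. *)
Lemma sqrt_quadratic_lipschitz (a l x y : R) : 0 <= a -> 0 <= l ->
  (Num.sqrt (a + l * x ^+ 2) - Num.sqrt (a + l * y ^+ 2)) ^+ 2 <= l * (x - y) ^+ 2.
Proof.
move=> a0 l0.
have h z : 0 <= a + l * z ^+ 2 by rewrite addr_ge0// mulr_ge0// sqr_ge0.
have [hx hy] := (h x, h y).
have cs : a + l * (x * y) <= Num.sqrt (a + l * x ^+ 2) * Num.sqrt (a + l * y ^+ 2).
  rewrite -sqrtrM//; apply: (le_trans (ler_norm _)); rewrite -sqrtr_sqr.
  rewrite ler_sqrt ?mulr_ge0// -subr_ge0.
  have -> : (a + l * x ^+ 2) * (a + l * y ^+ 2) - (a + l * (x * y)) ^+ 2 =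
     a * l * (x - y) ^+ 2 by ring.
  by rewrite mulr_ge0 ?sqr_ge0// mulr_ge0.
have := sqr_sqrtr hx; have := sqr_sqrtr hy; nra.
Qed.

Lemma profile_unique p lambda (U V : R -> R) : 2 < p -> 0 <= lambda ->
  profile p lambda U -> profile p lambda V -> U 0 = V 0 ->
  forall x, 0 <= x -> U x = V x.
Proof.
move=> p2 l0 pU pV UV x x0.
pose k := (p - 2) / 2; have k0 : 0 < k by rewrite /k; lra.
pose z y := U y `^ (- k) - V y `^ (- k).
have z00 : z 0 = 0 by rewrite /z UV subrr.
have dz y : 0 <= y <= x -> is_derive y 1 z
    (k * Num.sqrt (2 / p + lambda * (U y `^ (- k)) ^+ 2)
     - k * Num.sqrt (2 / p + lambda * (V y `^ (- k)) ^+ 2)).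
  by move=> /andP[y0 _]; apply: derB; exact: profile_linearized.
have zx : z x = 0.
  apply: (@gronwall_forward z _ x (k ^+ 2 * lambda) x0 dz _ z00) => y _.
  rewrite -mulrBr exprMn -mulrA ler_wpM2l ?sqr_ge0//.
  by apply: sqrt_quadratic_lipschitz => //; rewrite divr_ge0//; lra.
have [Ux _] := pU x x0; have [Vx _] := pV x x0.
have : U x `^ (- k) = V x `^ (- k) by rewrite /z in zx; lra.
move=> /(congr1 (fun t => t `^ (- k^-1))).
by rewrite -!powRrM mulrNN mulfV ?gt_eqF// !powRr1 ?ltW.
Qed.

End HalfLine.

(** * Integration by parts across a jump *)

Section JumpByParts.
Context {R : realType}.
Implicit Types (a b c x y : R).
Notation mu := (@lebesgue_measure R).

(** Building block of the cutoffs; a C^1 step is smooth enough, since weak derivatives are tested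
    against C^1_c functions. *)
Lemma smooth_step : exists S s : R -> R,
  [/\ (forall x : R, is_derive x 1 S (s x)), continuous s,
      (forall x, x <= 0 -> S x = 0 /\ s x = 0),
      (forall x, 1 <= x -> S x = 1 /\ s x = 0) &
      (forall x, 0 <= S x <= 1 /\ 0 <= s x <= 6)].
Proof.
pose pos x := (x + `|x|) / 2.
have cpos (f : R -> R) : continuous f -> continuous (fun x => pos (f x)).
  move=> cf; apply: continuous_mul; last exact: continuous_const.
  by apply: continuous_plus => //; exact: continuous_norm.
have pos0 x : x <= 0 -> pos x = 0.
  by move=> x0; rewrite /pos ler0_norm// subrr mul0r.
have posE x : 0 <= x -> pos x = x by move=> x0; rewrite /pos ger0_norm//; field.
have posge0 x : 0 <= pos x.
  by have [/pos0 ->//|/ltW x0] := leP x 0; rewrite posE.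
(* The integral of x (1 - x) over [0, 1] is 1/6; there [S] is 3 x^2 - 2 x^3. *)
pose s x := 6 * (pos x * pos (1 - x)).
have cs : continuous s.
  apply: continuous_mul; first exact: continuous_const.
  apply: continuous_mul; apply: cpos; first exact: continuous_id.
  by apply: continuous_plus; [exact: continuous_const|apply: continuous_opp; exact: continuous_id].
have [T dT] := antiderivative cs.
pose S x := T x - T 0.
have dS x : is_derive x 1 S (s x).
  by apply: (derE (derB (dT x) (derC _ x))); rewrite subr0.
have sl x : x <= 0 -> s x = 0 by move=> x0; rewrite /s pos0// mul0r mulr0.
have sr x : 1 <= x -> s x = 0.
  by move=> x1; rewrite /s [pos (1 - x)]pos0 ?mulr0//; lra.
have S0 : S 0 = 0 by rewrite /S subrr.
have S1 : S 1 = 1.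
  have d x : 0 <= x <= 1 -> is_derive x 1 (fun x => 3 * x ^+ 2 - 2 * x ^+ 3) (s x).
    move=> /andP[x0 x1].
    apply: (derE (derB (derZ 3 (derX 2 (derid x))) (derZ 2 (derX 3 (derid x))))).
    by rewrite /s posE// posE; [rewrite /=; ring|lra].
  have := der_eq ler01 (fun x _ => dS x) d.
  by rewrite S0 expr0n /= !expr1n; lra.
have Sl x : x <= 0 -> S x = 0.
  move=> x0; rewrite -S0; apply: (der_0_cst x0) => y /andP[_ y0].
  by rewrite -(sl y).
have Sr x : 1 <= x -> S x = 1.
  move=> x1; rewrite -S1; apply/esym; apply: (der_0_cst x1) => y /andP[y1 _].
  by rewrite -(sr y).
have s0 x : 0 <= s x by apply: mulr_ge0; [lra|apply: mulr_ge0; exact: posge0].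
have mono x y : x <= y -> S x <= S y.
  by move=> xy; apply: (der_ge0_le xy (fun z _ => dS z)).
exists S, s; split => // x; [by split; [exact: Sl|exact: sl]|by split; [exact: Sr|exact: sr]|].
split.
  apply/andP; split.
    by have [/Sl ->//|x0] := leP x 0; rewrite -S0 mono// ltW.
  by have [/ltW x1|/Sr ->//] := ltP x 1; rewrite -S1 mono.
rewrite s0 /=; have [/sl ->//|/ltW x0] := leP x 0.
have [x1|/ltW/sr ->//] := leP x 1.
rewrite /s !posE//; last lra.
by nra.
Qed.

Lemma continuous_ext_itv (f g : R -> R) a b x : a < x < b ->
  (forall t, a < t < b -> f t = g t) -> {for x, continuous f} ->
  {for x, continuous g}.
Proof.
move=> axb fg cf; rewrite /prop_for /continuous_at -(fg x axb).
apply: cvg_trans cf; apply: near_eq_cvg.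
case/andP: axb => ax xb.
near=> t; apply: fg; apply/andP; split; near: t.
  exact: lt_nbhsr.
exact: lt_nbhsl.
Unshelve. all: by end_near. Qed.

Lemma integrable_mul_bounded (f h : R -> R) (M : R) :
  mu.-integrable setT (EFin \o f) -> continuous h -> (forall x, `|h x| <= M) ->
  mu.-integrable setT (EFin \o (fun x => f x * h x)).
Proof.
move=> intf ch hM.
have mf : measurable_fun setT f by move/integrableP : intf => [/measurable_EFinP].
have M0 : 0 <= M := le_trans (normr_ge0 _) (hM 0).
have intf' := integrableZl measurableT M intf.
apply: le_integrable intf' => //.
  by apply/measurable_EFinP; apply: measurable_funM => //; exact: continuous_measurable_fun.
move=> x _ /=; rewrite lee_fin !normrM (ger0_norm M0) mulrC.
by rewrite ler_wpM2r.
Qed.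

Lemma Rintegral_cutoff_cvg (f : R -> R) (h : nat -> R -> R) (M : R) :
  mu.-integrable setT (EFin \o f) -> (forall n, continuous (h n)) ->
  (forall n x, `|h n x| <= M) ->
  (forall x, x != 0 -> \forall n \near \oo, h n x = 1) ->
  \int[mu]_x (f x * h n x) @[n --> \oo] --> \int[mu]_x f x.
Proof.
move=> intf ch hM h1.
have mf : measurable_fun setT f by move/integrableP : intf => [/measurable_EFinP].
have M0 : 0 <= M := le_trans (normr_ge0 _) (hM 0%N 0).
have intn n := integrable_mul_bounded intf (ch n) (hM n).
have intg : mu.-integrable setT (EFin \o (fun x => M * `|f x|)).
  have := integrableZl measurableT M (integrable_abse intf).
  by apply: eq_integrable.
have [|||||_ _ h2] := @dominated_convergence _ _ R mu setT measurableT
  (fun n => EFin \o (fun x => f x * h n x)) (EFin \o f)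
  (EFin \o (fun x => M * `|f x|)).
- by move=> n; case/integrableP: (intn n).
- exact/measurable_EFinP.
(* The cutoffs tend to 1 only away from 0, a null set. *)
- exists [set 0]; split => //; first exact: lebesgue_measure_set1.
  move=> x /= nx; apply: contrapT => x0; apply: nx => _.
  apply: cvg_near_cst.
  have /h1 := (introN eqP x0).
  by apply: filterS => n /= ->; rewrite mulr1.
- exact: intg.
- apply: aeW => x n _ /=; rewrite lee_fin normrM mulrC.
  by rewrite ler_wpM2r.
apply: fine_cvg; rewrite fineK; last exact: integrable_fin_num.
exact: h2.
Qed.

(** The integral is an average of [h] for the probability density [rho], so only the values of [h]
    where [rho] is nonzero count. Applied to densities that shrink to 0 from one side, it yields
    one-sided limits. *)
Lemma Rintegral_concentrate (rho h : R -> R) c (M N e : R) : 0 <= e ->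
  continuous rho -> (forall x, 0 <= rho x <= M) -> 0 < N ->
  (forall x, N <= `|x| -> rho x = 0) -> \int[mu]_x rho x = 1 ->
  mu.-integrable setT (EFin \o h) ->
  (forall x, rho x != 0 -> `|h x - c| <= e) ->
  `|\int[mu]_x (h x * rho x) - c| <= e.
Proof.
move=> e0 crho rho0 N0 rhoN rho1 inth hc.
have irho : mu.-integrable setT (EFin \o rho).
  exact: integrable_compact_support rhoN.
have ihr : mu.-integrable setT (EFin \o (fun x => h x * rho x)).
  apply: (@integrable_mul_bounded _ _ M) => // x.
  by rewrite ger0_norm; case/andP: (rho0 x).
have icr : mu.-integrable setT (EFin \o (fun x => c * rho x)).
  by have := integrableZl measurableT c irho.
have ier : mu.-integrable setT (EFin \o (fun x => e * rho x)).
  by have := integrableZl measurableT e irho.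
have -> : c = \int[mu]_x (c * rho x) by rewrite RintegralZl// rho1 mulr1.
rewrite -RintegralB//.
apply: (le_trans (le_normr_Rintegral _ _)) => //.
  by have := integrableB measurableT ihr icr; apply: eq_integrable.
have -> : e = \int[mu]_x (e * rho x) by rewrite RintegralZl// rho1 mulr1.
apply: le_Rintegral => //.
  have := integrable_abse (integrableB measurableT ihr icr).
  by apply: eq_integrable.
move=> x _; rewrite -mulrBl normrM.
case/andP: (rho0 x) => r0 _; rewrite (ger0_norm r0).
have [->|rx] := eqVneq (rho x) 0; first by rewrite !mulr0.
by rewrite ler_wpM2r// hc.
Qed.

(* The functions [w * chi n] are C^1_c tests, where [chi n] vanishes near 0 and
   outside a large interval. Of the terms of its derivative, [dB n] is O(1/n)
   and [rp n], [rm n] are approximations of the one-sided Dirac masses at 0. *)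
Lemma jump_by_parts (w dw phi dphi : R -> R) a b : H1_with phi dphi ->
  L2 w -> L2 dw ->
  (forall x, x != 0 -> is_derive x 1 w (dw x)) ->
  (forall x, x != 0 -> {for x, continuous dw}) ->
  w x @[x --> 0^'+] --> a -> w x @[x --> 0^'-] --> b ->
  \int[mu]_x (w x * dphi x) + \int[mu]_x (dw x * phi x) = (b - a) * phi 0.
Proof.
move=> [cphi l2phi l2dphi wphi] l2w l2dw wd cdw wa wb.
have [S [s [dS cs Sl Sr Sb]]] := smooth_step.
have cS := der_continuousT dS.
have caff c d : continuous (fun x => c * x - d).
  apply: continuous_plus; last exact: continuous_const.
  by apply: continuous_mul; [exact: continuous_const|exact: continuous_id].
have cSaff (f : R -> R) c d : continuous f -> continuous (fun x => f (c * x - d)).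
  move=> cf x; apply: (@continuous_comp _ _ _ (fun x => c * x - d) f).
    exact: caff.
  exact: cf.
have dSaff c d x : is_derive x 1 (fun x => S (c * x - d)) (c * s (c * x - d)).
  apply: (derE (der_comp (dS _) (derB (derZ c (derid x)) (derC d x)))).
  by ring.
pose N (n : nat) : R := n%:R + 2.
have N2 n : 2 <= N n by rewrite /N; have : 0 <= n%:R :> R by []; lra.
have N0 n : 0 < N n by have := N2 n; lra.
have NV n : 0 < (N n)^-1 by rewrite invr_gt0.
have NV1 n : (N n)^-1 <= 2^-1 by rewrite lef_pV2// posrE.
have NNV n : N n * (N n)^-1 = 1 by rewrite mulfV ?gt_eqF.
(* With N = [N n], [rp n] lives on [1/N, 2/N], [rm n] on [-2/N, -1/N] and [dB n] on N <= |x| <= 2 N,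
   while [chi n] is 1 for 2/N <= |x| <= N. The bound N >= 2 keeps the small and the large scale
   apart. *)
pose rp n x := N n * s (N n * x - 1).
pose rm n x := N n * s (- N n * x - 1).
pose dB n x := (N n)^-1 * (s (- (N n)^-1 * x - 1) - s ((N n)^-1 * x - 1)).
pose chi n x := S (N n * x - 1) + S (- N n * x - 1)
  - S ((N n)^-1 * x - 1) - S (- (N n)^-1 * x - 1).
have crp n : continuous (rp n).
  by apply: continuous_mul; [exact: continuous_const|exact: cSaff].
have crm n : continuous (rm n).
  by apply: continuous_mul; [exact: continuous_const|exact: cSaff].
have cdB n : continuous (dB n).
  apply: continuous_mul; first exact: continuous_const.
  by apply: continuous_plus; [|apply: continuous_opp]; exact: cSaff.
have cchi n : continuous (chi n).
  apply: continuous_plus; last by apply: continuous_opp; exact: cSaff.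
  apply: continuous_plus; last by apply: continuous_opp; exact: cSaff.
  by apply: continuous_plus; exact: cSaff.
have dchi n x : is_derive x 1 (chi n) (rp n x - rm n x + dB n x).
  apply: (derE (derB (derB (derD (dSaff (N n) 1 x) (dSaff (- N n) 1 x))
    (dSaff (N n)^-1 1 x)) (dSaff (- (N n)^-1) 1 x))).
  by rewrite /rp /rm /dB; ring.
have chib n x : `|chi n x| <= 2.
  rewrite /chi ler_norml.
  have [/andP[? ?] _] := Sb (N n * x - 1).
  have [/andP[? ?] _] := Sb (- N n * x - 1).
  have [/andP[? ?] _] := Sb ((N n)^-1 * x - 1).
  have [/andP[? ?] _] := Sb (- (N n)^-1 * x - 1).
  lra.
have near0 n x : `|x| <= (N n)^-1 ->
    chi n x = 0 /\ rp n x - rm n x + dB n x = 0.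
  rewrite ler_norml => /andP[x1 x2].
  have NVn := NV n; have NV1n := NV1 n; have N0n := N0 n; have NNVn := NNV n.
  have h1 : N n * x - 1 <= 0 by nra.
  have h2 : - N n * x - 1 <= 0 by nra.
  have h3 : (N n)^-1 * x - 1 <= 0 by nra.
  have h4 : - (N n)^-1 * x - 1 <= 0 by nra.
  have [e1 f1] := Sl _ h1; have [e2 f2] := Sl _ h2.
  have [e3 f3] := Sl _ h3; have [e4 f4] := Sl _ h4.
  by rewrite /chi /rp /rm /dB e1 e2 e3 e4 f1 f2 f3 f4; split; ring.
have far n x : 2 * N n <= `|x| ->
    [/\ chi n x = 0, rp n x = 0, rm n x = 0 & dB n x = 0].
  have NVn := NV n; have NV1n := NV1 n; have N2n := N2 n; have NNVn := NNV n.
  have [x0|x0] := leP 0 x.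
    rewrite ger0_norm// => xN.
    have h1 : 1 <= N n * x - 1 by nra.
    have h2 : - N n * x - 1 <= 0 by nra.
    have h3 : 1 <= (N n)^-1 * x - 1 by nra.
    have h4 : - (N n)^-1 * x - 1 <= 0 by nra.
    have [e1 f1] := Sr _ h1; have [e2 f2] := Sl _ h2.
    have [e3 f3] := Sr _ h3; have [e4 f4] := Sl _ h4.
    by rewrite /chi /rp /rm /dB e1 e2 e3 e4 f1 f2 f3 f4; split; ring.
  rewrite ltr0_norm// => xN.
  have h1 : N n * x - 1 <= 0 by nra.
  have h2 : 1 <= - N n * x - 1 by nra.
  have h3 : (N n)^-1 * x - 1 <= 0 by nra.
  have h4 : 1 <= - (N n)^-1 * x - 1 by nra.
  have [e1 f1] := Sl _ h1; have [e2 f2] := Sr _ h2.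
  have [e3 f3] := Sl _ h3; have [e4 f4] := Sr _ h4.
  by rewrite /chi /rp /rm /dB e1 e2 e3 e4 f1 f2 f3 f4; split; ring.
have iwdphi := L2_integrableM l2w l2dphi.
have iwphi := L2_integrableM l2w l2phi.
have idwphi := L2_integrableM l2dw l2phi.
have rpb n x : 0 <= rp n x <= N n * 6.
  have [_ /andP[s0 s6]] := Sb (N n * x - 1).
  by rewrite /rp mulr_ge0 ?ler_wpM2l// ltW.
have rmb n x : 0 <= rm n x <= N n * 6.
  have [_ /andP[s0 s6]] := Sb (- N n * x - 1).
  by rewrite /rm mulr_ge0 ?ler_wpM2l// ltW.
have dBb n x : `|dB n x| <= (N n)^-1 * 12.
  have [_ /andP[? ?]] := Sb (- (N n)^-1 * x - 1).
  have [_ /andP[? ?]] := Sb ((N n)^-1 * x - 1).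
  rewrite /dB normrM gtr0_norm// ler_wpM2l ?(ltW (NV n))// ler_norml; lra.
have id1 n : mu.-integrable setT (EFin \o (fun x => w x * dphi x * chi n x)).
  exact: (integrable_mul_bounded iwdphi (cchi n) (chib n)).
have id2 n : mu.-integrable setT (EFin \o (fun x => dw x * phi x * chi n x)).
  exact: (integrable_mul_bounded idwphi (cchi n) (chib n)).
have id3 n : mu.-integrable setT (EFin \o (fun x => w x * phi x * dB n x)).
  exact: (integrable_mul_bounded iwphi (cdB n) (dBb n)).
have id4 n : mu.-integrable setT (EFin \o (fun x => w x * phi x * rp n x)).
  apply: (@integrable_mul_bounded _ _ (N n * 6) iwphi (crp n)) => x.
  by rewrite ger0_norm; case/andP: (rpb n x).
have id5 n : mu.-integrable setT (EFin \o (fun x => w x * phi x * rm n x)).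
  apply: (@integrable_mul_bounded _ _ (N n * 6) iwphi (crm n)) => x.
  by rewrite ger0_norm; case/andP: (rmb n x).
have key n : \int[mu]_x (w x * dphi x * chi n x)
    + \int[mu]_x (dw x * phi x * chi n x)
    + \int[mu]_x (w x * phi x * dB n x)
    + \int[mu]_x (w x * phi x * rp n x)
    - \int[mu]_x (w x * phi x * rm n x) = 0.
  (* [f] vanishes identically near 0, so the jump of [w] does no harm and [f] is an admissible test
     for the weak derivative of [phi]. *)
  pose f x := w x * chi n x.
  pose df x := dw x * chi n x + w x * (rp n x - rm n x + dB n x).
  have near00 x : - (N n)^-1 < x < (N n)^-1 -> f x = 0 /\ df x = 0.
    move=> xN; have [|e1 e2] := near0 n x.
      by rewrite ler_norml; lra.
    by rewrite /f /df e1 e2; split; ring.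
  have dfE x : is_derive x 1 f (df x).
    have [->|x0] := eqVneq x 0.
      have z0 : - (N n)^-1 < 0 < (N n)^-1 by have := NV n; lra.
      rewrite (near00 0 z0).2.
      apply: (der_ext_itv z0 _ (derC 0 0)) => t /near00[-> _] //.
    exact: (derM (wd x x0) (dchi n x)).
  have cdf : continuous df.
    move=> x; have [->|x0] := eqVneq x 0.
      have z0 : - (N n)^-1 < 0 < (N n)^-1 by have := NV n; lra.
      apply: (continuous_ext_itv z0 _ (@continuous_const _ 0 0)).
      by move=> t /near00[_ ->].
    apply: cvgD; apply: cvgM.
    - exact: cdw.
    - exact: cchi.
    - exact: (der_continuous (wd x x0)).
    - by apply: cvgD; [apply: cvgB; [exact: crp|exact: crm]|exact: cdB].
  have f0 x : 2 * N n <= `|x| -> f x = 0.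
    by move=> /far[e _ _ _]; rewrite /f e mulr0.
  have := wphi f (C1cI dfE cdf f0).
  have -> : derive1 f = df by apply/funext => x; exact: der_derive1.
  have -> : \int[mu]_x (phi x * df x) = \int[mu]_x (dw x * phi x * chi n x)
    + (\int[mu]_x (w x * phi x * dB n x) + (\int[mu]_x (w x * phi x * rp n x)
    - \int[mu]_x (w x * phi x * rm n x))).
    rewrite -RintegralB//.
    have i45 : mu.-integrable setT
        (EFin \o (fun x => w x * phi x * rp n x - w x * phi x * rm n x)).
      by have := integrableB measurableT (id4 n) (id5 n); apply: eq_integrable.
    rewrite -RintegralD//.
    have i345 : mu.-integrable setT (EFin \o (fun x => w x * phi x * dB n x
        + (w x * phi x * rp n x - w x * phi x * rm n x))).
      by have := integrableD measurableT (id3 n) i45; apply: eq_integrable.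
    rewrite -RintegralD//.
    by apply: eq_Rintegral => x _; rewrite /df; ring.
  have -> : \int[mu]_x (dphi x * f x) = \int[mu]_x (w x * dphi x * chi n x).
    by apply: eq_Rintegral => x _; rewrite /f; ring.
  set i1 := \int[mu]_x _; set i2 := \int[mu]_x _; set i3 := \int[mu]_x _.
  set i4 := \int[mu]_x _; set i5 := \int[mu]_x _.
  by move=> e; lra.
have chi1 x : x != 0 -> \forall n \near \oo, chi n x = 1.
  move=> x0; have ax : 0 < `|x| by rewrite normr_gt0.
  near=> n.
  have n1 : `|x| <= N n.
    suff : `|x| <= n%:R by rewrite /N; lra.
    by near: n; exact: nbhs_infty_ger.
  have n2 : 2 <= N n * `|x|.
    have : 2 / `|x| <= n%:R by near: n; exact: nbhs_infty_ger.
    by rewrite ler_pdivrMr// /N; nra.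
  have NVn := NV n; have N0n := N0 n; have NNVn := NNV n.
  have n3 : (N n)^-1 * `|x| <= 1 by rewrite mulrC ler_pdivrMr ?mul1r.
  rewrite /chi; have [x0'|x0'] := leP 0 x.
    rewrite ger0_norm// in n1 n2 n3.
    have h2 : - N n * x - 1 <= 0 by nra.
    have h4 : - (N n)^-1 * x - 1 <= 0 by nra.
    have [e1 _] := Sr (N n * x - 1) ltac:(lra).
    have [e2 _] := Sl _ h2.
    have [e3 _] := Sl ((N n)^-1 * x - 1) ltac:(lra).
    have [e4 _] := Sl _ h4.
    by rewrite e1 e2 e3 e4; ring.
  rewrite ltr0_norm// in n1 n2 n3.
  have h1 : N n * x - 1 <= 0 by nra.
  have h3 : (N n)^-1 * x - 1 <= 0 by nra.
  have [e1 _] := Sl _ h1.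
  have [e2 _] := Sr (- N n * x - 1) ltac:(lra).
  have [e3 _] := Sl _ h3.
  have [e4 _] := Sl (- (N n)^-1 * x - 1) ltac:(lra).
  by rewrite e1 e2 e3 e4; ring.
have l1 := Rintegral_cutoff_cvg iwdphi cchi chib chi1.
have l2 := Rintegral_cutoff_cvg idwphi cchi chib chi1.
have NVcvg : (N n)^-1 @[n --> \oo] --> 0.
  apply/cvgr0Pnorm_lt => e e0; near=> n.
  rewrite gtr0_norm//.
  have : e^-1 < n%:R by near: n; exact: nbhs_infty_gtr.
  move=> en; rewrite -[ltRHS]invrK ltf_pV2 ?posrE ?invr_gt0//.
  by rewrite /N; lra.
have l3 : \int[mu]_x (w x * phi x * dB n x) @[n --> \oo] --> 0.
  apply/norm_cvg0P.
  pose I := \int[mu]_x `|w x * phi x|.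
  have : (N n)^-1 * (12 * I) @[n --> \oo] --> 0 * (12 * I).
    by apply: cvgM; [exact: NVcvg|exact: cvg_cst].
  rewrite mul0r; apply: squeeze_cvgr (cvg_cst 0).
  near=> n; rewrite normr_ge0/=.
  apply: (le_trans (le_normr_Rintegral measurableT (id3 n))).
  rewrite mulrA -RintegralZl//; last exact: (integrable_abse iwphi).
  apply: le_Rintegral => //.
  - exact: (integrable_abse (id3 n)).
  - by have := integrableZl measurableT ((N n)^-1 * 12) (integrable_abse iwphi);
      apply: eq_integrable.
  - by move=> x _; rewrite normrM mulrC ler_wpM2r.
have mass1 n : \int[mu]_x rp n x = 1.
  have M0 : 0 < 2 * N n by rewrite mulr_gt0.
  apply: (etrans (Rintegral_compact_support M0 (crp n) _
    (fun x => dSaff (N n) 1 x))).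
    by move=> x /far[].
  have NN := N2 n.
  have [-> _] := Sr (N n * (2 * N n) - 1) ltac:(nra).
  have [-> _] := Sl (N n * - (2 * N n) - 1) ltac:(nra).
  by rewrite subr0.
have mass2 n : \int[mu]_x rm n x = 1.
  have M0 : 0 < 2 * N n by rewrite mulr_gt0.
  have dm x : is_derive x 1 (fun x => - S (- N n * x - 1)) (rm n x).
    by apply: (derE (derN (dSaff (- N n) 1 x))); rewrite /rm; ring.
  apply: (etrans (Rintegral_compact_support M0 (crm n) _ dm)).
    by move=> x /far[].
  have NN := N2 n.
  have [-> _] := Sl (- N n * (2 * N n) - 1) ltac:(nra).
  have [-> _] := Sr (- N n * - (2 * N n) - 1) ltac:(nra).
  by ring.
have wphia : w x * phi x @[x --> 0^'+] --> a * phi 0.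
  by apply: cvgM => //; apply: cvg_at_right_filter; exact: cphi.
have wphib : w x * phi x @[x --> 0^'-] --> b * phi 0.
  by apply: cvgM => //; apply: cvg_at_left_filter; exact: cphi.
have small d : 0 < d -> \forall n \near \oo, 2 / N n < d.
  move=> d0; near=> n; rewrite ltr_pdivrMr//.
  have : 2 / d < n%:R by near: n; exact: nbhs_infty_gtr.
  by rewrite ltr_pdivrMr// /N; nra.
have l4 : \int[mu]_x (w x * phi x * rp n x) @[n --> \oo] --> a * phi 0.
  apply/cvgrPdist_le => e e0.
  have /cvgrPdist_le/(_ e e0)[d /= d0 hd] := wphia.
  near=> n; rewrite distrC.
  have N2n : 0 < 2 * N n by rewrite mulr_gt0.
  apply: (Rintegral_concentrate (ltW e0) (crp n) (rpb n) N2n _ (mass1 n) iwphi).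
    by move=> x /far[].
  move=> x; rewrite /rp mulf_eq0 gt_eqF//= => sx.
  have h0 : 0 < N n * x - 1 by rewrite ltNge; apply: contra sx => /Sl[_ ->].
  have h1 : N n * x - 1 < 1 by rewrite ltNge; apply: contra sx => /Sr[_ ->].
  have N0n := N0 n.
  have x0 : 0 < x by nra.
  rewrite distrC; apply: hd => //=.
  rewrite sub0r normrN gtr0_norm//.
  have : 2 / N n < d by near: n; exact: small.
  by apply: le_lt_trans; rewrite ler_pdivlMr//; lra.
have l5 : \int[mu]_x (w x * phi x * rm n x) @[n --> \oo] --> b * phi 0.
  apply/cvgrPdist_le => e e0.
  have /cvgrPdist_le/(_ e e0)[d /= d0 hd] := wphib.
  near=> n; rewrite distrC.
  have N2n : 0 < 2 * N n by rewrite mulr_gt0.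
  apply: (Rintegral_concentrate (ltW e0) (crm n) (rmb n) N2n _ (mass2 n) iwphi).
    by move=> x /far[].
  move=> x; rewrite /rm mulf_eq0 gt_eqF//= => sx.
  have h0 : 0 < - N n * x - 1 by rewrite ltNge; apply: contra sx => /Sl[_ ->].
  have h1 : - N n * x - 1 < 1 by rewrite ltNge; apply: contra sx => /Sr[_ ->].
  have N0n := N0 n.
  have x0 : x < 0 by nra.
  rewrite distrC; apply: hd => //=.
  rewrite sub0r normrN ltr0_norm//.
  have : 2 / N n < d by near: n; exact: small.
  by apply: le_lt_trans; rewrite ler_pdivlMr//; lra.
set i1 := \int[mu]_x _; set i2 := \int[mu]_x _.
have lim : \int[mu]_x (w x * dphi x * chi n x)
    + \int[mu]_x (dw x * phi x * chi n x)
    + \int[mu]_x (w x * phi x * dB n x)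
    + \int[mu]_x (w x * phi x * rp n x)
    - \int[mu]_x (w x * phi x * rm n x) @[n --> \oo]
    --> i1 + i2 + 0 + a * phi 0 - b * phi 0.
  by apply: cvgB l5; apply: cvgD l4; apply: cvgD l3; exact: cvgD.
have := cvg_lim (@Rhausdorff R) lim.
have -> := funext key.
move=> /(_ eventually_filter); rewrite lim_cst// => e.
clearbody i1 i2; lra.
Unshelve. all: by end_near. Qed.

End JumpByParts.

(** * Existence and integrability of profiles *)

Section Profiles.
Context {R : realType}.
Implicit Types (a b c x y p lambda t : R).
Notation mu := (@lebesgue_measure R).

(** Supplies the bounded antiderivative assumed for orbits. The bound is two-sided so that
    [- P (- x)] can serve for the reflected left half. *)
Lemma L2_antiderivative_bounded (u : R -> R) : continuous u -> L2 u ->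
  exists P C, (forall x : R, is_derive x 1 P (u x ^+ 2)) /\
    forall x, `|P x| <= C.
Proof.
move=> cu /L2P[_ intu].
have cu2 : continuous (fun x => u x ^+ 2).
  move=> x; apply: (@continuous_comp _ _ _ u (fun y : R => y ^+ 2)).
    exact: cu.
  exact: exprn_continuous.
have [Q dQ] := antiderivative cu2.
pose I := \int[mu]_x (u x ^+ 2).
have QI a b : a <= b -> 0 <= Q b - Q a <= I.
  rewrite le_eqVlt => /predU1P[->|ab].
    by rewrite subrr lexx/=; apply: Rintegral_ge0 => x _; exact: sqr_ge0.
  have cQ := der_continuousT dQ.
  have -> : Q b - Q a = \int[mu]_(x in `[a, b]) (u x ^+ 2).
    rewrite /Rintegral (@continuous_FTC2 _ (fun x => u x ^+ 2) Q)//.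
    - exact: continuous_subspaceT.
    - split; first by move=> x _; exact: ex_derive.
      + by apply/cvg_at_right_filter; exact: cQ.
      + by apply/cvg_at_left_filter; exact: cQ.
    - by move=> x _; exact: der_derive1.
  rewrite Rintegral_ge0/=; last by move=> x _; exact: sqr_ge0.
  apply: fine_le.
  - by apply: integrable_fin_num => //; exact: integrable_segment.
  - exact: integrable_fin_num.
  - apply: ge0_subset_integral => //.
      by case/integrableP: intu.
    by move=> x _; rewrite lee_fin sqr_ge0.
exists (fun x => Q x - Q 0), I; split.
  by move=> x; apply: (derE (derB (dQ x) (derC _ x))); rewrite subr0.
move=> x; rewrite ler_norml; have [x0|/ltW x0] := leP 0 x.
  by have := QI _ _ x0; lra.
by have := QI _ _ x0; lra.
Qed.

(** By symmetry the integral is twice that over the right half-line, which is the limit of [P] at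
    infinity minus its value at 0; a bounded monotone [P] has a finite limit. *)
Lemma L2_even (U P : R -> R) C :
  (forall x, 0 <= x -> {for x, continuous U}) ->
  (forall x, 0 <= x -> is_derive x 1 P (U x ^+ 2)) ->
  (forall x, 0 <= x -> P x <= C) ->
  continuous (fun x => U `|x|) -> L2 (fun x => U `|x|).
Proof.
move=> cU dP PC cu.
have cu2 : continuous (fun x => U `|x| ^+ 2).
  move=> x; apply: (@continuous_comp _ _ _ (fun x => U `|x|) (fun y : R => y ^+ 2)).
    exact: cu.
  exact: exprn_continuous.
apply/L2P; split; first exact: continuous_measurable_fun.
apply/integrableP; split.
  by apply/measurable_EFinP; exact: continuous_measurable_fun.
have -> : (\int[mu]_x `|(EFin \o (fun x => (U `|x| ^+ 2)%R)) x|)%E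
    = (\int[mu]_x (U `|x| ^+ 2)%:E)%E.
  by apply: eq_integral => x _ /=; rewrite ger0_norm// sqr_ge0.
rewrite ge0_symfun_integralT//; [|by move=> x; rewrite sqr_ge0|by move=> x /=; rewrite normrN].
apply: lte_mul_pinfty => //.
(* [P] is controlled only for x >= 0; freezing it at [P 0] to the left makes it monotone and bounded
   above on the whole line. *)
pose G x := P (Num.max 0 x).
have ndG : nondecreasing_fun G.
  move=> x y xy; rewrite /G.
  have mxy : Num.max 0 x <= Num.max 0 y.
    by rewrite ge_max le_max lexx/= le_max xy orbT.
  apply: (@der_ge0_le _ P (fun z => U z ^+ 2) _ _ mxy) => [z /andP[z0 _]|z _];
    last exact: sqr_ge0.
  by apply: dP; apply: le_trans z0; rewrite le_max lexx.
have ubG : has_ubound (range G).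
  by exists C => _ [x _ <-]; apply: PC; rewrite le_max lexx.
have cvgG := nondecreasing_cvgr ndG ubG.
have cvgP : P x @[x --> +oo] --> sup (range G).
  apply: cvg_trans cvgG; apply: near_eq_cvg.
  near=> x; rewrite /G max_r//.
have cu2' := continuous_subspaceT cu2.
have -> : [set x : R | 0 <= x] = `[0, +oo[%classic.
  by rewrite set_itvcy.
rewrite (@ge0_continuous_FTC2y _ _ P 0 (sup (range G)))//.
- by rewrite -EFinB ltry.
- by move=> x _; rewrite sqr_ge0.
- by move=> x x0; apply: ex_derive; exact: dP (ltW x0).
- apply: cvg_at_right_filter.
  exact: der_continuous (dP 0 (lexx 0)).
- move=> x; rewrite in_itv/= andbT => x0.
  by rewrite ger0_norm ?ltW//; apply: der_derive1; exact: dP (ltW x0).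
Unshelve. all: by end_near. Qed.

Lemma profile_of_linearized p lambda (w : R -> R) : 2 < p ->
  let k := (p - 2) / 2 in
  (forall x, 0 <= x -> 0 < w x /\
    is_derive x 1 w (k * Num.sqrt (2 / p + lambda * w x ^+ 2))) ->
  profile p lambda (fun x => w x `^ (- k^-1)).
Proof.
move=> p2 k wE x x0; have [wx dw] := wE x x0; split; first exact: powR_gt0.
have k0 : 0 < k by rewrite /k; lra.
apply: (derE (der_comp (is_derive1_powR (- k^-1) wx) dw)).
have -> : (w x `^ (- k^-1)) `^ (p - 2) = (w x)^-1 ^+ 2.
  rewrite -powRrM (_ : - k^-1 * (p - 2) = - 2%:R).
    by rewrite powR_invn ?ltW// exprVn.
  by rewrite /k; field; lra.
have -> : 2 / p * (w x)^-1 ^+ 2 + lambda = (w x)^-1 ^+ 2 * (2 / p + lambda * w x ^+ 2).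
  by field; rewrite !gt_eqF//; lra.
rewrite sqrtrM ?sqr_ge0// sqrtr_sqr ger0_norm ?invr_ge0 ?ltW//.
rewrite powRB ?(gt_eqF wx) ?implybT// powRr1 ?ltW//.
by field; rewrite !gt_eqF.
Qed.

Lemma profile_exists p lambda t : 2 < p -> 0 <= lambda -> 0 < t ->
  exists2 U : R -> R, profile p lambda U & U 0 = t.
Proof.
move=> p2 l0 t0.
pose k := (p - 2) / 2; have k0 : 0 < k by rewrite /k; lra.
pose w0 := t `^ (- k); have w00 : 0 < w0 by exact: powR_gt0.
suff [w wE w0E] : exists2 w : R -> R, (forall x, 0 <= x -> 0 < w x /\
    is_derive x 1 w (k * Num.sqrt (2 / p + lambda * w x ^+ 2))) & w 0 = w0.
  exists (fun x => w x `^ (- k^-1)); first exact: profile_of_linearized.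
  by rewrite w0E /w0 -powRrM mulrNN mulfV ?gt_eqF// powRr1 ?ltW.
have [p0 p1] := andP (two_div_itv p2).
move: l0; rewrite le_eqVlt => /predU1P[<-|l0].
  pose c := k * Num.sqrt (2 / p); have c0 : 0 < c by rewrite mulr_gt0 ?sqrtr_gt0.
  exists (fun x => w0 + c * x); last by rewrite mulr0 addr0.
  move=> x x0; split; first by rewrite ltr_wpDr// mulr_ge0// ltW.
  apply: (derE (derD (derC w0 x) (derZ c (derid x)))).
  by rewrite mul0r addr0 /c; ring.
pose sl := Num.sqrt lambda; have sl0 : 0 < sl by rewrite sqrtr_gt0.
have sl2 : sl ^+ 2 = lambda by rewrite sqr_sqrtr ?ltW.
(* The solution is w0 cosh (kap x) + c sinh (kap x), and [c] is read off from the equation at x = 0.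
   The identity [c2] is the value of the conserved quantity (w'/k)^2 - lambda w^2. *)
pose c := Num.sqrt (2 / p + lambda * w0 ^+ 2) / sl.
have r0 : 0 <= 2 / p + lambda * w0 ^+ 2.
  by rewrite addr_ge0 ?(ltW p0)// mulr_ge0 ?sqr_ge0// ltW.
have c2 : lambda * (c ^+ 2 - w0 ^+ 2) = 2 / p.
  rewrite /c expr_div_n sqr_sqrtr// sl2.
  by field; rewrite !gt_eqF//; lra.
have c0 : 0 <= c by rewrite /c divr_ge0 ?sqrtr_ge0 ?ltW.
have cw : w0 <= c.
  rewrite -(@ler_pXn2r _ 2) ?nnegrE ?(ltW w00)// -subr_ge0.
  by rewrite -(pmulr_rge0 _ l0) c2 ltW.
pose kap := k * sl; have kap0 : 0 < kap by rewrite mulr_gt0.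
pose w x := (w0 + c) / 2 * expR (kap * x) + (w0 - c) / 2 * expR (- kap * x).
exists w; last by rewrite /w !mulr0 expR0; field.
move=> x x0.
have e1 : 1 <= expR (kap * x) by rewrite -expR0 ler_expR mulr_ge0// ltW.
have e2 : 0 < expR (- kap * x) <= 1.
  by rewrite expR_gt0 -expR0 ler_expR mulNr oppr_le0 mulr_ge0// ltW.
have e12 : expR (kap * x) * expR (- kap * x) = 1 by rewrite -expRD mulNr subrr expR0.
split; first by rewrite /w; nra.
pose dw := kap * ((w0 + c) / 2 * expR (kap * x) - (w0 - c) / 2 * expR (- kap * x)).
apply: (@derE _ _ _ dw).
  apply: (derE (derD (derZ _ (der_expRM kap x)) (derZ _ (der_expRM (- kap) x)))).
  by rewrite /dw; ring.
have dw0 : 0 <= dw / k.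
  rewrite divr_ge0 ?(ltW k0)// mulr_ge0 ?(ltW kap0)//.
  by move: (expR _) (expR _) e1 e2 => E1 E2 e1 e2; nra.
have dw2 : (dw / k) ^+ 2 = 2 / p + lambda * w x ^+ 2.
  rewrite -c2 -sl2 /dw /kap /w.
  have -> : c ^+ 2 - w0 ^+ 2 = (c ^+ 2 - w0 ^+ 2) * (expR (kap * x) * expR (- kap * x)).
    by rewrite e12 mulr1.
  by rewrite /kap; move: (expR _) (expR _) => E1 E2; field; rewrite gt_eqF.
rewrite -dw2 sqrtr_sqr ger0_norm// mulrC divfK// gt_eqF//.
Qed.

Lemma profile_le0 p lambda (U : R -> R) x : profile p lambda U -> 0 <= x ->
  U x <= U 0.
Proof.
move=> pU x0; rewrite -lerN2.
apply: (@der_ge0_le _ (fun y => - U y) _ _ _ x0 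
  (fun y yx => derN (pU y (andP yx).1).2)) => y /andP[y0 _].
rewrite opprK mulr_ge0 ?sqrtr_ge0// ltW//.
by have [] := pU y y0.
Qed.

Lemma profile_decreasing p lambda (U : R -> R) x y : 2 < p -> 0 <= lambda ->
  profile p lambda U -> 0 <= x -> x < y -> U y < U x.
Proof.
move=> p2 l0 pU x0 xy.
have [p0 p1] := andP (two_div_itv p2).
have [c /andP[xc cy] e] := der_mvt (ltW xy)
  (fun z zxy => (pU z (le_trans x0 (andP zxy).1)).2).
have [Uc _] := pU c (le_trans x0 xc).
rewrite -subr_lt0 e nmulr_rlt0 ?subr_gt0// oppr_lt0 mulr_gt0// sqrtr_gt0.
by rewrite ltr_wpDr// mulr_gt0// powR_gt0.
Qed.

(* For lambda > 0, P + U^2 / (2 sqrt lambda) is nonincreasing; for lambda = 0,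
   P + U^(3 - p/2) / ((3 - p/2) sqrt (2/p)) is constant. *)
Lemma profile_antiderivative_bounded p lambda (U P : R -> R) : 2 < p ->
  0 < lambda \/ lambda = 0 /\ p < 6 -> profile p lambda U ->
  (forall x, 0 <= x -> is_derive x 1 P (U x ^+ 2)) ->
  exists C, forall x, 0 <= x -> P x <= C.
Proof.
move=> p2 hl pU dP; have [p0 p1] := andP (two_div_itv p2).
case: hl => [l0|[l0 p6]].
  pose s := Num.sqrt lambda; have s0 : 0 < s by rewrite sqrtr_gt0.
  exists (P 0 + U 0 ^+ 2 / (2 * s)) => x x0.
  have dQ y (yx : 0 <= y <= x) := derN (derD (dP y (andP yx).1)
    (derZ (2 * s)^-1 (derX 2 (pU y (andP yx).1).2))).
  have := der_ge0_le x0 dQ.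
  rewrite /= => h; have Ux : 0 <= (2 * s)^-1 * U x ^+ 2.
    by rewrite mulr_ge0 ?sqr_ge0// invr_ge0; lra.
  suff : - (P 0 + (2 * s)^-1 * U 0 ^+ 2) <= - (P x + (2 * s)^-1 * U x ^+ 2).
    by rewrite [U 0 ^+ 2 / _]mulrC; lra.
  apply: h => y /andP[y0 _]; have [Uy _] := pU y y0; rewrite expr1.
  set r := Num.sqrt _.
  have sr : s <= r.
    rewrite ler_sqrt ?lerDr; first by rewrite mulr_ge0 ?powR_ge0 ?ltW.
    by apply: addr_ge0; [rewrite mulr_ge0 ?powR_ge0 ?(ltW p0)|exact: ltW].
  rewrite oppr_ge0.
  have -> : U y ^+ 2 + (2 * s)^-1 * (2 * U y * - (U y * r)) = U y ^+ 2 * (1 - r / s).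
    by field; rewrite gt_eqF.
  rewrite pmulr_rle0 ?exprn_gt0// subr_le0 ler_pdivlMr// mul1r//.
pose c := Num.sqrt (2 / p); have c0 : 0 < c by rewrite sqrtr_gt0.
pose m := 3 - p / 2; have m0 : 0 < m by rewrite /m; lra.
exists (P 0 + U 0 `^ m / (m * c)) => x x0.
have dQ y (yx : 0 <= y <= x) := derD (dP y (andP yx).1)
    (derZ (m * c)^-1 (der_comp (is_derive1_powR m (pU y (andP yx).1).1)
       (pU y (andP yx).1).2)).
have e : P 0 + (m * c)^-1 * U 0 `^ m = P x + (m * c)^-1 * U x `^ m.
  apply: (@der_0_cst _ (fun y => P y + (m * c)^-1 * U y `^ m) _ _ x0) => y yx.
  apply: (derE (dQ y yx)).
  have [Uy _] := pU y (andP yx).1.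
  rewrite l0 addr0 sqrtrM ?(ltW p0)//.
  have -> : Num.sqrt (U y `^ (p - 2)) = U y `^ ((p - 2) / 2).
    by rewrite -powR12_sqrt ?powR_ge0// -powRrM.
  have -> : U y ^+ 2 = U y `^ (m - 1) * (U y * U y `^ ((p - 2) / 2)).
    rewrite -{3}[U y](powRr1 (ltW Uy)) -!powRD ?(gt_eqF Uy) ?implybT//.
    by rewrite -powR_mulrn ?ltW//; congr (_ `^ _); rewrite /m; field.
  by rewrite -/c; field; rewrite !gt_eqF.
have Ux : 0 <= (m * c)^-1 * U x `^ m.
  by rewrite mulr_ge0 ?powR_ge0// invr_ge0 mulr_ge0 ?ltW.
by rewrite [U 0 `^ m / _]mulrC; lra.
Qed.

(* For p >= 6, (ln U)' = - sqrt (2/p) U^((p-2)/2) >= - K U^2, so a bound on P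
   would keep U away from 0. *)
Lemma profile_antiderivative_unbounded p (U P : R -> R) C : 6 <= p ->
  profile p 0 U -> (forall x, 0 <= x -> is_derive x 1 P (U x ^+ 2)) ->
  (forall x, 0 <= x -> P x <= C) -> False.
Proof.
move=> p6 pU dP PC; have p2 : 2 < p by lra.
have [p0 p1] := andP (two_div_itv p2).
pose c := Num.sqrt (2 / p); have c0 : 0 < c by rewrite sqrtr_gt0.
(* Since p >= 6 and [U] is at most [U 0], the factor U^((p-6)/2) left over from U^2 is at most its
   value at 0. *)
pose K := c * U 0 `^ ((p - 6) / 2).
have K0 : 0 <= K by rewrite mulr_ge0 ?powR_ge0 ?ltW.
have U0 : 0 < U 0 by have [] := pU 0 (lexx 0).
(* The lower bound for [U] obtained because [ln U + K P] is nondecreasing and [P] is at most [C]. *)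
pose d := expR (ln (U 0) + K * P 0 - K * C).
have d0 : 0 < d ^+ 2 by rewrite exprn_gt0// expR_gt0.
apply: (sqr_not_bounded_below dP PC d0 (lexx 0)) => x x0.
have [Ux _] := pU x x0.
rewrite ler_sqr ?nnegrE ?expR_ge0 ?(ltW Ux)//.
rewrite -(lnK Ux) ler_expR.
have dQ y (yx : 0 <= y <= x) := derD (der_comp (is_derive1_ln (pU y (andP yx).1).1)
   (pU y (andP yx).1).2) (derZ K (dP y (andP yx).1)).
have KP : K * P x <= K * C by rewrite ler_wpM2l// PC.
suff : ln (U 0) + K * P 0 <= ln (U x) + K * P x by lra.
apply: (der_ge0_le x0 dQ) => y /andP[y0 _]; have [Uy _] := pU y y0.
rewrite addr0 sqrtrM ?(ltW p0)// -/c.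
have -> : Num.sqrt (U y `^ (p - 2)) = U y `^ ((p - 6) / 2) * U y ^+ 2.
  rewrite -powR12_sqrt ?powR_ge0// -powRrM -powR_mulrn ?ltW//.
  by rewrite -powRD ?(gt_eqF Uy) ?implybT//; congr (_ `^ _); field.
have -> : (U y)^-1 * - (U y * (c * (U y `^ ((p - 6) / 2) * U y ^+ 2)))
    + K * U y ^+ 2 = c * (U 0 `^ ((p - 6) / 2) - U y `^ ((p - 6) / 2)) * U y ^+ 2.
  by rewrite /K; field; rewrite gt_eqF.
rewrite mulr_ge0 ?sqr_ge0// mulr_ge0 ?(ltW c0)// subr_ge0.
by apply: ler_powR_base; [lra|exact: ltW|exact: profile_le0 pU y0].
Qed.

End Profiles.

(** * Solutions and even profiles *)

Section Shooting.
Context {R : realType}.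
Implicit Types (a b c x y p q lambda t : R) (u v : R -> R).
Notation mu := (@lebesgue_measure R).

(* The jump condition for an even function with [t = u 0], after division by [t]. *)
Definition jump p q lambda t :=
  2 * Num.sqrt (2 / p * t `^ (p - 2) + lambda) = t `^ (q - 2).

(** A separate [U] is needed because [u] has a corner at 0, whereas [profile] asks for a two-sided
    derivative there. The last clause encodes square integrability when [lambda = 0]. *)
Definition even_profile p q lambda u := exists U : R -> R,
  [/\ profile p lambda U, 0 <= lambda, (forall x, u x = U `|x|),
      jump p q lambda (U 0) & (lambda = 0 -> p < 6)].

(** The sign [e] treats both signs of [u 0] at once, the nonlinearity being odd. The right half and
    the reflected left half are profiles with the same value at 0, hence equal, which is evenness;
    the jump condition then involves twice one slope. *)
Lemma solution_even_profile p q lambda u e : 2 < p -> solution p q lambda u ->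
  e = 1 \/ e = -1 -> 0 < e * u 0 -> even_profile p q lambda (fun x => e * u x).
Proof.
move=> p2 solu e1 eu0; have [p0 p1] := andP (two_div_itv p2).
have [ur [vr [ul [vl [dur dvr uE dul [dvl uNE jmp]]]]]] := solution_classical p2 solu.
case: solu => _ [cu l2u _ _] _.
have [P [C [dP PC]]] := L2_antiderivative_bounded cu l2u.
have e2 : e ^+ 2 = 1 by case: e1 => ->; rewrite ?sqrrN expr1n.
have en : `|e| = 1 by case: e1 => ->; rewrite ?normrN normr1.
have nonlinE z : e * nonlin p lambda z = nonlin p lambda (e * z).
  by rewrite /nonlin normrM en mul1r; ring.
have dr x : 0 <= x -> is_derive x 1 (fun x => e * ur x) (e * vr x).
  by move=> x0; apply: derZ.
have ddr x : 0 <= x -> is_derive x 1 (fun x => e * vr x) (nonlin p lambda (e * ur x)).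
  by move=> x0; rewrite -nonlinE -uE//; apply: derZ.
have dl x : 0 <= x -> is_derive x 1 (fun x => e * ul x) (e * vl x).
  by move=> x0; apply: derZ.
have ddl x : 0 <= x -> is_derive x 1 (fun x => e * vl x) (nonlin p lambda (e * ul x)).
  by move=> x0; rewrite -nonlinE -uNE//; apply: derZ.
have Pr x : 0 <= x -> is_derive x 1 P ((e * ur x) ^+ 2).
  by move=> x0; rewrite exprMn e2 mul1r -uE.
have PrC x : 0 <= x -> P x <= C by move=> _; apply: le_trans (PC x); exact: ler_norm.
have Pl x : 0 <= x -> is_derive x 1 (fun x => - P (- x)) ((e * ul x) ^+ 2).
  move=> x0; rewrite exprMn e2 mul1r -uNE//.
  apply: (derE (derN (der_comp (dP _) (derN (derid x))))); ring.
have PlC x : 0 <= x -> - P (- x) <= C.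
  by move=> _; apply: le_trans (PC (- x)); rewrite -normrN; exact: ler_norm.
have u0 : u 0 = ur 0 by exact: uE.
have u0' : u 0 = ul 0 by rewrite -uNE// oppr0.
have ur0 : 0 < e * ur 0 by rewrite -u0.
have ul0 : 0 < e * ul 0 by rewrite -u0'.
have [l0 vrE] := orbit_profile p2 dr ddr Pr PrC ur0.
have [_ vlE] := orbit_profile p2 dl ddl Pl PlC ul0.
have pr : profile p lambda (fun x => e * ur x).
  move=> x x0; split; first exact: (orbit_gt0 p2 dr ddr Pr PrC ur0).
  by rewrite -vrE//; exact: dr.
have pl : profile p lambda (fun x => e * ul x).
  move=> x x0; split; first exact: (orbit_gt0 p2 dl ddl Pl PlC ul0).
  by rewrite -vlE//; exact: dl.
have rl := profile_unique p2 l0 pr pl (congr1 (fun t => e * t) (etrans (esym u0) u0')).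
exists (fun x => e * ur x); split => //.
- move=> x; have [x0|/ltW x0] := leP 0 x; first by rewrite ger0_norm// uE.
  rewrite ler0_norm// rl ?oppr_ge0//; congr (_ * _).
  by rewrite -uNE ?oppr_ge0// opprK.
- rewrite /jump.
  have := vrE 0 (lexx 0); have := vlE 0 (lexx 0).
  rewrite -u0 -u0'; set s := Num.sqrt _ => h1 h2.
  have nu0 : `|u 0| = e * u 0 by rewrite -[RHS]gtr0_norm// normrM en mul1r.
  apply: (mulfI (lt0r_neq0 eu0)).
  transitivity (- (e * (vr 0 + vl 0))); first by rewrite mulrDr h1 h2; ring.
  by rewrite jmp nu0; ring.
- move=> l00; rewrite ltNge; apply/negP => p6.
  rewrite l00 in pr.
  exact: (profile_antiderivative_unbounded p6 pr Pr PrC).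
Qed.

Lemma solution_zero p q lambda u : 2 < p -> solution p q lambda u -> u 0 = 0 ->
  forall x, u x = 0.
Proof.
move=> p2 solu u0.
have [ur [vr [ul [vl [dur dvr uE dul [dvl uNE jmp]]]]]] := solution_classical p2 solu.
case: solu => _ [cu l2u _ _] _.
have [P [C [dP PC]]] := L2_antiderivative_bounded cu l2u.
move=> x; have [x0|/ltW x0] := leP 0 x.
  rewrite uE//; apply: (@orbit_zero R p lambda ur vr P C p2) => //.
  - by move=> y y0; rewrite -uE.
  - by move=> y y0; rewrite -uE.
  - by move=> y _; apply: le_trans (PC y); exact: ler_norm.
  - by rewrite -uE.
rewrite -[x]opprK uNE ?oppr_ge0//.
apply: (@orbit_zero R p lambda ul vl (fun x => - P (- x)) C p2) => //.
- by move=> y y0; rewrite -uNE.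
- move=> y y0; rewrite -uNE//.
  by apply: (derE (derN (der_comp (dP _) (derN (derid y))))); ring.
- by move=> y _; apply: le_trans (PC (- y)); rewrite -normrN; exact: ler_norm.
- by rewrite -uNE ?oppr0.
- by rewrite oppr_ge0.
Qed.

(** The function differentiated is - U', so this recovers the second-order equation from the
    first-order one. *)
Lemma profile_slope p lambda (U : R -> R) x : 2 < p -> 0 <= lambda ->
  profile p lambda U -> 0 <= x ->
  is_derive x 1 (fun y => U y * Num.sqrt (2 / p * U y `^ (p - 2) + lambda))
    (- nonlin p lambda (U x)).
Proof.
move=> p2 l0 pU x0; have [p0 p1] := andP (two_div_itv p2).
have [Ux dU] := pU x x0.
have g0 : 0 < 2 / p * U x `^ (p - 2) + lambda.
  by rewrite ltr_wpDr// mulr_gt0// powR_gt0.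
have dg := derD (derZ (2 / p) (der_comp (is_derive1_powR (p - 2) Ux) dU)) (derC lambda x).
have ds := @der_comp _ Num.sqrt (fun y => 2 / p * U y `^ (p - 2) + lambda) x _ _
  (is_derive1_sqrt g0) dg.
apply: (derE (derM dU ds)); rewrite /nonlin (gtr0_norm Ux).
have s2 := sqr_sqrtr (ltW g0); move: s2.
have s0 : 0 < Num.sqrt (2 / p * U x `^ (p - 2) + lambda) by rewrite sqrtr_gt0.
move: (Num.sqrt _) s0 => s s0 s2.
have w1 : U x `^ (p - 2 - 1) = U x `^ (p - 2) / U x.
  by rewrite powRB ?(gt_eqF Ux) ?implybT// powRr1// ltW.
rewrite w1.
transitivity (- (U x * s ^+ 2) - U x * (p - 2) / p * U x `^ (p - 2)).
  by field; rewrite !gt_eqF//; lra.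
by rewrite s2; field; lra.
Qed.

(** [jump_by_parts] is used twice: for [u], continuous at 0, it shows that [du] is the weak
    derivative; for [du], whose one-sided limits at 0 are opposite, it yields the weak form with its
    point term. *)
Lemma even_profile_solution p q lambda u : 2 < p ->
  even_profile p q lambda u -> positive_solution p q lambda u.
Proof.
move=> p2 [U [pU l0 uE jmp l06]]; have [p0 p1] := andP (two_div_itv p2).
have pp : 0 < p - 2 by lra.
have uE' : u = fun x => U `|x| by apply/funext.
split; last by move=> x; rewrite uE; have [] := pU `|x| (normr_ge0 x).
pose r y := U y * Num.sqrt (2 / p * U y `^ (p - 2) + lambda).
have dr x : 0 <= x -> is_derive x 1 r (- nonlin p lambda (U x)).
  exact: profile_slope.
have cabs (f : R -> R) : (forall x, 0 <= x -> {for x, continuous f}) ->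
    continuous (fun x => f `|x|).
  move=> cf x; apply: (@continuous_comp _ _ _ (fun y : R => `|y|) f).
    exact: norm_continuous.
  exact: cf.
have cU x : 0 <= x -> {for x, continuous U}.
  by move=> x0; exact: der_continuous (pU x x0).2.
have cr x : 0 <= x -> {for x, continuous r}.
  by move=> x0; exact: der_continuous (dr x x0).
have cu : continuous u by rewrite uE'; exact: cabs.
have cra : continuous (fun x => r `|x|) by exact: cabs.
have U0 x : 0 < U `|x| by have [] := pU `|x| (normr_ge0 x).
pose du x := if 0 <= x then - r `|x| else r `|x|.
have l2u : L2 u.
  have cu2 : continuous (fun x => u x ^+ 2).
    move=> x; apply: (@continuous_comp _ _ _ u (fun y : R => y ^+ 2)).
      exact: cu.
    exact: exprn_continuous.
  have [P dP] := antiderivative cu2.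
  have dP' x : 0 <= x -> is_derive x 1 P (U x ^+ 2).
    by move=> x0; apply: (derE (dP x)); rewrite uE ger0_norm.
  have hl : 0 < lambda \/ lambda = 0 /\ p < 6.
    move: l0; rewrite le_eqVlt => /predU1P[l00|]; last by left.
    by right; split; [|exact: l06].
  have [C PC] := profile_antiderivative_bounded p2 hl pU dP'.
  by rewrite uE'; apply: (L2_even cU dP' PC); exact: cabs.
have mdu : measurable_fun setT du.
  apply: measurable_fun_ifT.
  - by apply: measurable_fun_ler => //; exact: measurable_id.
  - by apply: continuous_measurable_fun; exact: continuous_opp.
  - exact: continuous_measurable_fun.
have UpU0 x : U `|x| `^ (p - 2) <= U 0 `^ (p - 2).
  apply: ler_powR_base; [exact: ltW|exact: ltW|exact: profile_le0 pU (normr_ge0 x)].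
have l2du : L2 du.
  (* The first-order equation bounds [du] by a constant times [u], so square integrability passes
     from [u] to [du]. *)
  apply: (@L2_le _ _ _ (Num.sqrt (2 / p * U 0 `^ (p - 2) + lambda)) mdu l2u) => x.
  have -> : `|du x| = `|r `|x| | by rewrite /du; case: ifP => //; rewrite normrN.
  rewrite uE /r normrM mulrC ler_wpM2r// ger0_norm ?sqrtr_ge0//.
  rewrite ler_sqrt ?lerD2r ?ler_wpM2l ?(ltW p0)//.
  by rewrite addr_ge0// mulr_ge0 ?powR_ge0// ltW.
have cn : continuous (fun x => nonlin p lambda (u x)) by exact: continuous_nonlin.
have cpow : continuous (fun x => `|u x| `^ (p - 2) * u x).
  apply: continuous_mul => // x.
  apply: (@continuous_comp _ _ _ u (fun y => `|y| `^ (p - 2))); first exact: cu.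
  exact: continuous_normr_powR.
have l2pow : L2 (fun x => `|u x| `^ (p - 2) * u x).
  apply: (@L2_le _ _ _ (U 0 `^ (p - 2)) _ l2u) => [|x].
    exact: continuous_measurable_fun.
  by rewrite normrM ger0_norm ?powR_ge0// ler_wpM2r// uE gtr0_norm.
have l2n : L2 (fun x => nonlin p lambda (u x)).
  apply: (@L2_le _ _ _ (U 0 `^ (p - 2) + lambda) _ l2u) => [|x].
    exact: continuous_measurable_fun.
  have ux : 0 < u x by rewrite uE.
  rewrite /nonlin (gtr0_norm ux) ger0_norm.
    by rewrite -mulrDl ler_wpM2r ?lerD2r ?uE// ltW.
  by rewrite addr_ge0 ?mulr_ge0 ?powR_ge0// ltW.
have dudx x : x != 0 -> is_derive x 1 u (du x).
  rewrite neq_lt => /orP[x0|x0].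
    apply: (@der_ext_itv _ (fun y => U (- y)) _ (x - 1) x 0); first lra.
      by move=> y /andP[_ y0]; rewrite uE ltr0_norm.
    have Nx0 : 0 <= - x by lra.
    apply: (derE (@der_comp _ U (fun y => - y) x _ _ (pU _ Nx0).2 (derN (derid x)))).
    by rewrite /du leNgt x0/= (ltr0_norm x0) /r; ring.
  apply: (@der_ext_itv _ U _ 0 x (x + 1)); first lra.
    by move=> y /andP[y0 _]; rewrite uE gtr0_norm.
  by apply: (derE (pU _ (ltW x0)).2); rewrite /du (ltW x0) (gtr0_norm x0).
have ddudx x : x != 0 -> is_derive x 1 du (nonlin p lambda (u x)).
  rewrite neq_lt => /orP[x0|x0].
    apply: (@der_ext_itv _ (fun y => r (- y)) _ (x - 1) x 0); first lra.
      by move=> y /andP[_ y0]; rewrite /du leNgt y0/= ltr0_norm.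
    have Nx0 : 0 <= - x by lra.
    apply: (derE (@der_comp _ r (fun y => - y) x _ _ (dr _ Nx0) (derN (derid x)))).
    by rewrite uE (ltr0_norm x0); ring.
  apply: (@der_ext_itv _ (fun y => - r y) _ 0 x (x + 1)); first lra.
    by move=> y /andP[y0 _]; rewrite /du (ltW y0) gtr0_norm.
  by apply: (derE (derN (dr _ (ltW x0)))); rewrite uE (gtr0_norm x0) opprK.
have wdu : weak_derivative u du.
  move=> phi Cphi; have [dphi cphi' _] := Cphi.
  have phid x : is_derive x 1 phi (derive1 phi x).
    by rewrite derive1E; apply: derivableP; exact: dphi.
  have [N N0 phi0] := C1c_support Cphi.
  have H1phi := C1c_H1 phid cphi' phi0.
  have := @jump_by_parts R u du phi _ (u 0) (u 0) H1phi l2u l2du dudx.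
  rewrite subrr mul0r => h; apply/eqP; rewrite -addr_eq0; apply/eqP; apply: h.
  - by move=> x x0; exact: der_continuous (ddudx x x0).
  - by apply: cvg_at_right_filter; exact: cu.
  - by apply: cvg_at_left_filter; exact: cu.
exists du; first by split.
move=> phi dphi H1phi; have [_ l2phi _ _] := H1phi.
have dur : du x @[x --> 0^'+] --> - r 0.
  rewrite (_ : - r 0 = - r `|0 : R|); last by rewrite normr0.
  apply: (@cvg_trans _ (- r `|x| @[x --> (0 : R)^'+])).
    apply: near_eq_cvg; near=> x.
    have x0 : 0 < x by near: x; exact: nbhs_right_gt.
    by rewrite /du (ltW x0).
  by apply: cvg_at_right_filter; exact: (continuous_opp cra).
have dul : du x @[x --> 0^'-] --> r 0.
  rewrite (_ : r 0 = r `|0 : R|); last by rewrite normr0.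
  apply: (@cvg_trans _ (r `|x| @[x --> (0 : R)^'-])).
    apply: near_eq_cvg; near=> x.
    have x0 : x < 0 by near: x; exact: nbhs_left_lt.
    by rewrite /du leNgt x0.
  by apply: cvg_at_left_filter; exact: cra.
have := jump_by_parts H1phi l2du l2n ddudx (fun x _ => cn x) dur dul.
have -> : \int[mu]_x (nonlin p lambda (u x) * phi x) =
    \int[mu]_x (`|u x| `^ (p - 2) * u x * phi x) + lambda * \int[mu]_x (u x * phi x).
  have iup := L2_integrableM l2u l2phi.
  rewrite -RintegralZl//.
  rewrite -RintegralD//; last 2 first.
  - exact: (L2_integrableM l2pow l2phi).
  - by have := integrableZl measurableT lambda iup; apply: eq_integrable.
  by apply: eq_Rintegral => x _; rewrite /nonlin; ring.
have -> : `|u 0| `^ (q - 2) * u 0 = r 0 - - r 0.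
  have U00 := U0 0; rewrite normr0 in U00.
  by rewrite uE normr0 gtr0_norm// -jmp /r; ring.
set i1 := \int[mu]_x _; set i2 := \int[mu]_x _; set i3 := \int[mu]_x _.
by clearbody i1 i2 i3; lra.
Unshelve. all: by end_near. Qed.

End Shooting.

(** * Counting the values at the origin *)

Section Roots.
Context {R : realType}.
Implicit Types (a b c l p q lambda s t x y : R).

Lemma powR_inj a x y : a != 0 -> 0 < x -> 0 < y -> x `^ a = y `^ a -> x = y.
Proof.
move=> a0 x0 y0 /(congr1 (fun z => z `^ a^-1)).
by rewrite -!powRrM mulfV// !powRr1 ?ltW.
Qed.

Lemma powR_root a y : a != 0 -> 0 < y -> exists2 x, 0 < x & x `^ a = y.
Proof.
move=> a0 y0; exists (y `^ a^-1); first exact: powR_gt0.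
by rewrite -powRrM mulVf// powRr1// ltW.
Qed.

(* For [a = 2 (q - 2)], [b = p - 2], [c = 2 / p], this is the only [lambda >= 0]
   for which [t] can satisfy the jump condition. *)
Definition height a b c t := t `^ a / 4 - c * t `^ b.

Lemma height_factorl a b c t : 0 < t ->
  height a b c t = t `^ b * (t `^ (a - b) / 4 - c).
Proof.
by move=> t0; rewrite powRB ?(gt_eqF t0) ?implybT// /height; field;
  rewrite gt_eqF// powR_gt0.
Qed.

Lemma height_factorr a b c t : 0 < t ->
  height a b c t = t `^ a * (4^-1 - c * t `^ (b - a)).
Proof.
by move=> t0; rewrite powRB ?(gt_eqF t0) ?implybT// /height; field;
  rewrite gt_eqF// powR_gt0.
Qed.

Lemma der_height a b c t : 0 < t ->
  is_derive t 1 (height a b c) (t `^ (a - 1) * (a / 4 - c * b * t `^ (b - a))).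
Proof.
move=> t0.
have d := derB (derZ 4^-1 (is_derive1_powR a t0)) (derZ c (is_derive1_powR b t0)).
apply: (@der_ext _ (fun y => 4^-1 * y `^ a - c * y `^ b)).
  by move=> y; rewrite /height mulrC.
apply: (derE d); rewrite !powRB ?(gt_eqF t0) ?implybT//.
by rewrite powRr1 ?ltW//; field; rewrite !gt_eqF// powR_gt0.
Qed.

Lemma height_continuous a b c x y : 0 < x -> {within `[x, y], continuous (height a b c)}.
Proof.
move=> x0; apply: derivable_within_continuous => t; rewrite in_itv/= => /andP[xt _].
by apply: ex_derive; apply: der_height; exact: lt_le_trans xt.
Qed.

Lemma height_ivt a b c x y l : 0 < x -> x <= y ->
  Num.min (height a b c x) (height a b c y) <= l
    <= Num.max (height a b c x) (height a b c y) ->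
  exists2 t, x <= t <= y & height a b c t = l.
Proof.
move=> x0 xy h; have [t txy e] := IVT xy (@height_continuous a b c x y x0) h.
by exists t => //; rewrite in_itv in txy.
Qed.

(** Both factors in [height_factorl] increase; positivity at [x] ensures that the second one is
    positive, so that their product increases too. *)
Lemma height_lt a b c x y : 0 < b -> b < a -> 0 < x -> x < y ->
  0 < height a b c x -> height a b c x < height a b c y.
Proof.
move=> b0 ba x0 xy; have y0 : 0 < y by exact: lt_trans xy.
rewrite !height_factorl// => hx.
have xb : x `^ b < y `^ b by exact: ltr_powR_base b0 (ltW x0) xy.
have ab0 : 0 < a - b by lra.
have xab : x `^ (a - b) < y `^ (a - b) by exact: ltr_powR_base ab0 (ltW x0) xy.
move: hx; rewrite pmulr_rgt0 ?powR_gt0// => hx.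
by apply: ltr_pM => //; [exact: powR_ge0|exact: ltW|lra].
Qed.

Lemma height_inj a b c x y : 0 < b -> b < a -> 0 < x -> 0 < y ->
  0 < height a b c x -> height a b c x = height a b c y -> x = y.
Proof.
move=> b0 ba x0 y0 hx e; case: (ltgtP x y) => // xy.
  by have := height_lt b0 ba x0 xy hx; rewrite e ltxx.
by have := @height_lt a b c _ _ b0 ba y0 xy; rewrite -e ltxx => /(_ hx).
Qed.

Lemma height_surj a b c l : 0 < b -> b < a -> 0 < c -> 0 < l ->
  exists2 t, 0 < t & height a b c t = l.
Proof.
move=> b0 ba c0 l0; have ab0 : 0 < a - b by lra.
have ab1 := lt0r_neq0 ab0; have b1 := lt0r_neq0 b0.
have c40 : 0 < 4 * c by rewrite mulr_gt0.
(* [x] is the zero of [height]. At [y] the second factor of [height_factorl] equals 1 and at [z] the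
   first equals [l], so at their maximum [T] the product is at least [l]. *)
have [x x0 xE] := powR_root ab1 c40.
have c41 : 0 < 4 * (1 + c) by lra.
have [y y0 yE] := powR_root ab1 c41.
have [z z0 zE] := powR_root b1 l0.
pose T : R := Num.max y z.
have yT : y <= T by rewrite le_max lexx.
have zT : z <= T by rewrite le_max lexx orbT.
have T0 : 0 < T by exact: lt_le_trans yT.
have xy : x <= y.
  rewrite leNgt; apply/negP => yx.
  by have := ltr_powR_base ab0 (ltW y0) yx; rewrite xE yE; lra.
have hx : height a b c x = 0 by rewrite height_factorl// xE; field.
have hT : l <= height a b c T.
  rewrite height_factorl// -[l]mulr1; apply: ler_pM => //; first exact: ltW.
    by rewrite -[X in X <= _]zE; apply: ler_powR_base => //; exact: ltW.
  have : y `^ (a - b) <= T `^ (a - b) by apply: ler_powR_base => //; exact: ltW.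
  by rewrite yE; lra.
have [|t /andP[xt _] e] := @height_ivt a b c x T l x0 (le_trans xy yT).
  by rewrite hx ge_min (ltW l0)/= le_max hT orbT.
by exists t => //; exact: lt_le_trans xt.
Qed.

(** [height] increases up to its only critical point [s] and decreases afterwards, so a positive
    level below the maximum is taken once on each side. *)
Lemma height_two_roots a b c : 0 < a -> a < b -> 0 < c -> exists s : R,
  [/\ 0 < s, 0 < height a b c s, (forall t, 0 < t -> height a b c t <= height a b c s),
   (forall t, 0 < t -> height a b c t = height a b c s -> t = s) &
   (forall l, 0 < l -> l < height a b c s -> exists x y,
     [/\ 0 < x, x < y, height a b c x = l, height a b c y = l &
       forall t, 0 < t -> height a b c t = l -> t = x \/ t = y])].
Proof.
move=> a0 ab c0; have b0 : 0 < b by lra.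
have ba0 : 0 < b - a by lra.
have ba1 := lt0r_neq0 ba0; have a1 := lt0r_neq0 a0.
(* The derivative vanishes exactly when t^(b-a) has this value. *)
have q0 : 0 < a / (4 * c * b) by rewrite divr_gt0// !mulr_gt0.
have [s s0 sE] := powR_root ba1 q0.
have cb0 : 0 < c * b by rewrite mulr_gt0.
have factorE t : a / 4 - c * b * t `^ (b - a) = c * b * (s `^ (b - a) - t `^ (b - a)).
  by rewrite sE; field; rewrite !gt_eqF.
have mvt x y : 0 < x -> x < y -> exists2 z, x < z < y &
    height a b c y - height a b c x =
    z `^ (a - 1) * (c * b * (s `^ (b - a) - z `^ (b - a))) * (y - x).
  move=> x0 xy.
  have dz z : z \in `]x, y[ -> is_derive z 1 (height a b c)
      (z `^ (a - 1) * (a / 4 - c * b * z `^ (b - a))).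
    by rewrite in_itv/= => /andP[xz _]; apply: der_height; exact: lt_trans xz.
  have [z + ->] := MVT xy dz (@height_continuous a b c x y x0).
  by rewrite in_itv/= => zxy; exists z => //; rewrite factorE.
have incr x y : 0 < x -> x < y -> y <= s -> height a b c x < height a b c y.
  move=> x0 xy ys; have [z /andP[xz zy] e] := mvt x y x0 xy.
  rewrite -subr_gt0 e; have z0 : 0 < z by exact: lt_trans xz.
  apply: mulr_gt0; last by rewrite subr_gt0.
  apply: mulr_gt0; first exact: powR_gt0.
  apply: mulr_gt0 => //; rewrite subr_gt0.
  by apply: ltr_powR_base; [|exact: ltW|exact: lt_le_trans ys].
have decr x y : s <= x -> x < y -> height a b c y < height a b c x.
  move=> sx xy; have x0 := lt_le_trans s0 sx.
  have [z /andP[xz zy] e] := mvt x y x0 xy.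
  rewrite -subr_lt0 e; have z0 : 0 < z by exact: lt_trans xz.
  rewrite pmulr_llt0 ?subr_gt0// pmulr_rlt0 ?powR_gt0// pmulr_rlt0// subr_lt0.
  by apply: ltr_powR_base; [|exact: ltW|exact: le_lt_trans xz].
have hs : 0 < height a b c s.
  rewrite height_factorr// mulr_gt0 ?powR_gt0// sE.
  have -> : 4^-1 - c * (a / (4 * c * b)) = (b - a) / (4 * b).
    by field; rewrite !gt_eqF.
  by rewrite divr_gt0// mulr_gt0.
exists s; split=> //.
- move=> t t0; case: (ltgtP t s) => [ts|st|->//]; first by rewrite ltW// incr.
  by rewrite ltW// decr.
- move=> t t0; case: (ltgtP t s) => // ts e.
    by have := incr _ _ t0 ts (lexx s); rewrite e ltxx.
  by have := decr _ _ (lexx s) ts; rewrite e ltxx.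
move=> l l0 ls.
have l40 : 0 < 4 * l by rewrite mulr_gt0.
(* Left end for the intermediate value theorem: as [height] is below t^a / 4, it is below [l] at the
   point where t^a = 4 l. *)
have [e e0 eE] := powR_root a1 l40.
have hb t : 0 < t -> height a b c t < t `^ a / 4.
  by move=> t0; rewrite /height ltrBlDr ltrDl mulr_gt0// powR_gt0.
have es : e < s.
  rewrite ltNge; apply/negP => se.
  have : s `^ a <= e `^ a by apply: ler_powR_base => //; exact: ltW.
  by have := hb s s0; rewrite eE; lra.
have he : height a b c e <= l by have := hb e e0; rewrite eE; lra.
have r0 : 0 < (4 * c)^-1 by rewrite invr_gt0 mulr_gt0.
(* Right end: the positive zero of [height], beyond [s] because a < b. *)
have [T T0 TE] := powR_root ba1 r0.
have hT : height a b c T = 0.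
  by rewrite height_factorr// TE; field; rewrite gt_eqF.
have sT : s < T.
  rewrite ltNge; apply/negP => Ts.
  have : T `^ (b - a) <= s `^ (b - a) by apply: ler_powR_base => //; exact: ltW.
  rewrite TE sE ler_pdivlMr ?mulr_gt0//.
  have -> : (4 * c)^-1 * (4 * c * b) = b by field; rewrite gt_eqF.
  lra.
have [|x /andP[ex xs] hx] := @height_ivt a b c e s l e0 (ltW es).
  by rewrite ge_min he/= le_max (ltW ls) orbT.
have [|y /andP[sy yT] hy] := @height_ivt a b c s T l s0 (ltW sT).
  by rewrite ge_min hT (ltW l0) orbT/= le_max (ltW ls).
have x0 : 0 < x by exact: lt_le_trans ex.
have xs' : x < s.
  by rewrite lt_neqAle xs andbT; apply/eqP => xse; rewrite xse in hx; lra.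
have sy' : s < y.
  by rewrite lt_neqAle sy andbT; apply/eqP => sye; rewrite -sye in hy; lra.
exists x, y; split => //; first exact: lt_trans sy'.
move=> t t0 ht; have [ts|/ltW st] := leP t s.
  left; case: (ltgtP t x) => // tx.
    by have := incr _ _ t0 tx xs; rewrite ht hx ltxx.
  by have := incr _ _ x0 tx ts; rewrite ht hx ltxx.
right; case: (ltgtP t y) => // ty.
  by have := decr _ _ st ty; rewrite ht hy ltxx.
by have := decr _ _ sy ty; rewrite ht hy ltxx.
Qed.

End Roots.

(** * Solutions and roots of the height function *)

Section Correspondence.
Context {R : realType}.
Implicit Types (p q lambda t x : R) (u v : R -> R).

(** Both sides of the jump condition are nonnegative, so squaring it is reversible; [lambda >= 0]
    keeps the radicand nonnegative. *)
Lemma jump_height p q lambda t : 2 < p -> 0 <= lambda -> 0 < t ->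
  jump p q lambda t <-> height (2 * (q - 2)) (p - 2) (2 / p) t = lambda.
Proof.
move=> p2 l0 t0; have [p0 p1] := andP (two_div_itv p2).
have g0 : 0 <= 2 / p * t `^ (p - 2) + lambda.
  by rewrite addr_ge0// mulr_ge0 ?powR_ge0// ltW.
have s2 := sqr_sqrtr g0; have s0 := sqrtr_ge0 (2 / p * t `^ (p - 2) + lambda).
have qE : t `^ (2 * (q - 2)) = (t `^ (q - 2)) ^+ 2.
  by rewrite -powR_mulrn ?powR_ge0// -powRrM mulrC.
have q0 := powR_ge0 t (q - 2).
rewrite /jump /height qE; split => [<-|h].
  by rewrite exprMn s2; field; lra.
apply/eqP; rewrite -(@eqrXn2 _ 2) ?mulr_ge0// exprMn s2 -h; apply/eqP.
by field; lra.
Qed.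

Lemma positive_solution_height p q lambda u : 2 < p ->
  positive_solution p q lambda u ->
  [/\ 0 < u 0, 0 <= lambda, height (2 * (q - 2)) (p - 2) (2 / p) (u 0) = lambda &
    lambda = 0 -> p < 6].
Proof.
move=> p2 [solu upos]; have u0 : 0 < 1 * u 0 by rewrite mul1r.
have [U [pU l0 uE jmp l06]] := solution_even_profile p2 solu (or_introl erefl) u0.
have U0 : U 0 = u 0 by have := uE 0; rewrite normr0 mul1r.
by split => //; apply/jump_height => //; rewrite -U0.
Qed.

Lemma positive_solution_exists p q lambda t : 2 < p -> 0 <= lambda ->
  (lambda = 0 -> p < 6) -> 0 < t ->
  height (2 * (q - 2)) (p - 2) (2 / p) t = lambda ->
  exists2 u, positive_solution p q lambda u & u 0 = t.
Proof.
move=> p2 l0 l06 t0 ht; have [U pU U0] := profile_exists p2 l0 t0.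
exists (fun x => U `|x|); last by rewrite normr0.
apply: even_profile_solution => //; exists U; split => //.
by rewrite U0; apply/jump_height.
Qed.

Lemma positive_solution_inj p q lambda u v : 2 < p ->
  positive_solution p q lambda u -> positive_solution p q lambda v ->
  u 0 = v 0 -> u = v.
Proof.
move=> p2 [solu upos] [solv vpos] uv.
have u0 : 0 < 1 * u 0 by rewrite mul1r.
have v0 : 0 < 1 * v 0 by rewrite mul1r.
have [U [pU l0 uE _ _]] := solution_even_profile p2 solu (or_introl erefl) u0.
have [V [pV _ vE _ _]] := solution_even_profile p2 solv (or_introl erefl) v0.
have UV : U 0 = V 0.
  by have := uE 0; have := vE 0; rewrite normr0 !mul1r => <- <-.
apply/funext => x; have := uE x; have := vE x; rewrite !mul1r => -> ->.
exact: profile_unique p2 l0 pU pV UV _ (normr_ge0 x).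
Qed.

Lemma nontrivial_solution_sign p q lambda u : 2 < p ->
  nontrivial_solution p q lambda u -> exists2 e : R, e = 1 \/ e = -1 &
  even_profile p q lambda (fun x => e * u x).
Proof.
move=> p2 [solu [x ux]]; case: (ltgtP (u 0) 0) => u0.
- by exists (-1); [right|apply: solution_even_profile => //; [right|lra]].
- by exists 1; [left|apply: solution_even_profile => //; [left|lra]].
- by rewrite (solution_zero p2 solu u0) eqxx in ux.
Qed.

Lemma nontrivial_solution_height p q lambda u : 2 < p ->
  nontrivial_solution p q lambda u -> exists2 t, 0 < t &
  0 <= lambda /\ height (2 * (q - 2)) (p - 2) (2 / p) t = lambda.
Proof.
move=> p2 /(nontrivial_solution_sign p2)[e _] /(even_profile_solution p2).
by move=> /(positive_solution_height p2)[t0 l0 ht _]; exists (e * u 0).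
Qed.

Lemma even_profile_radial p q lambda u : 2 < p -> even_profile p q lambda u ->
  [/\ even_fun u, positive u & radially_decreasing u].
Proof.
move=> p2 [U [pU l0 uE _ _]]; split.
- by move=> x; rewrite !uE normrN.
- by move=> x; rewrite uE; have [] := pU `|x| (normr_ge0 x).
- by move=> x y xy; rewrite !uE; exact: profile_decreasing p2 l0 pU (normr_ge0 x) xy.
Qed.

End Correspondence.

(** * The three regimes of q against p/2 + 1 *)

Unset Implicit Arguments.
Theorem theorem1p1 (R : realType) (p q : R) (hp : 2 < p) (hq : 2 < q) :
  (forall (lambda : R) (u : R -> R), nontrivial_solution p q lambda u ->
     even_fun u /\
     ((positive u /\ radially_decreasing u) \/
      (positive (fun x => - u x) /\ radially_decreasing (fun x => - u x))))
  /\
  (forall lambda : R, lambda < 0 ->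
     ~ exists u : R -> R, nontrivial_solution p q lambda u)
  /\
  (((exists u : R -> R, positive_solution p q 0 u) <->
      (2 < p /\ p < 6) /\ q <> p / 2 + 1) /\
   (forall u v : R -> R, positive_solution p q 0 u ->
      positive_solution p q 0 v -> u = v))
  /\
  (p / 2 + 1 < q -> forall lambda : R, 0 < lambda ->
     exists! u : R -> R, positive_solution p q lambda u)
  /\
  (q = p / 2 + 1 -> forall lambda : R, 0 < lambda ->
     ((exists u : R -> R, positive_solution p q lambda u) <-> 8 < p) /\
     (forall u v : R -> R, positive_solution p q lambda u ->
        positive_solution p q lambda v -> u = v))
  /\
  (q < p / 2 + 1 -> exists lambda_bar : R, 0 < lambda_bar /\
     (forall lambda : R, lambda_bar < lambda ->
        ~ exists u : R -> R, nontrivial_solution p q lambda u) /\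
     (exists! u : R -> R, positive_solution p q lambda_bar u) /\
     (forall lambda : R, 0 < lambda -> lambda < lambda_bar ->
        exists u v : R -> R, u <> v /\
          forall w : R -> R,
            positive_solution p q lambda w <-> (w = u \/ w = v))).
Proof.
have [p0 p1] := andP (two_div_itv hp).
pose H := @height R (2 * (q - 2)) (p - 2) (2 / p).
have b0 : 0 < p - 2 by lra.
have a0 : 0 < 2 * (q - 2) by lra.
have solE lambda u : positive_solution p q lambda u ->
    [/\ 0 < u 0, 0 <= lambda, H (u 0) = lambda & lambda = 0 -> p < 6].
  exact: positive_solution_height.
have solex (lambda t : R) : 0 <= lambda -> (lambda = 0 -> p < 6) -> 0 < t ->
    H t = lambda -> exists2 u, positive_solution p q lambda u & u 0 = t.
  exact: positive_solution_exists.
have solinj lambda u v : positive_solution p q lambda u ->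
    positive_solution p q lambda v -> u 0 = v 0 -> u = v.
  exact: positive_solution_inj.
split; [|split; [|split; [|split; [|split]]]].
- move=> lambda u /(nontrivial_solution_sign hp)[e e1].
  move=> /(even_profile_radial hp)[eu pu ru].
  have en : e != 0 by case: e1 => ->; rewrite ?oppr_eq0 oner_eq0.
  split; first by move=> x; apply: (mulfI en); exact: eu.
  case: e1 => eE; rewrite eE in pu ru; [left|right].
    by split=> [x|x y xy]; [have := pu x|have := ru x y xy]; rewrite !mul1r.
  by split=> [x|x y xy]; [have := pu x|have := ru x y xy]; rewrite !mulN1r.
- move=> lambda l0 [u /(nontrivial_solution_height hp)[t _ [l0' _]]].
  by move: l0'; rewrite leNgt l0.
- have rootE (t : R) : 0 < t -> H t = 0 -> t `^ (2 * (q - 2) - (p - 2)) = 8 / p.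
    move=> t0; rewrite /H height_factorl// => /eqP.
    rewrite mulf_eq0 (gt_eqF (powR_gt0 _ t0))/= => /eqP h.
    have -> : 8 / p = 4 * (2 / p) by field; lra.
    by move: (_ `^ _) (2 / p) h => X c h; lra.
  have key u : positive_solution p q 0 u -> p < 6 /\ q != p / 2 + 1.
    move=> /solE[u0 _ hu /(_ erefl) p6]; split=> //.
    (* At q = p/2 + 1 the exponent in [rootE] is 0, which forces p = 8 against p < 6. *)
    apply/eqP => qE; have := rootE _ u0 hu.
    have -> : 2 * (q - 2) - (p - 2) = 0 by rewrite qE; field.
    rewrite powRr0 => e; have : p * 1 = p * (8 / p) by rewrite -e.
    by rewrite mulrCA mulfV ?gt_eqF//; lra.
  split; last first.
    move=> u v su sv; have [_ qn] := key u su.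
    have [u0 _ hu _] := solE _ _ su; have [v0 _ hv _] := solE _ _ sv.
    apply: solinj su sv _; apply: (@powR_inj _ (2 * (q - 2) - (p - 2))) => //.
      by apply: contra qn => /eqP h; apply/eqP; lra.
    by rewrite !rootE.
  split=> [[u /key[p6 /eqP qn]]|[[_ p6] qn]]; first by split.
  have d0 : 2 * (q - 2) - (p - 2) != 0 by apply/eqP => h; apply: qn; lra.
  have p80 : 0 < 8 / p by rewrite divr_gt0//; lra.
  have [t t0 tE] := powR_root d0 p80.
  (* A nonzero exponent makes the power a bijection of the positive reals, so 8/p has a root [t]. *)
  have [|u su _] := solex 0 t (lexx 0) (fun=> p6) t0.
    by rewrite /H height_factorl// tE; field; lra.
  by exists u.
- move=> qp lambda l0.
  have ba : p - 2 < 2 * (q - 2) by lra.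
  have [t t0 ht] := height_surj b0 ba p0 l0.
  have ln0 : lambda = 0 -> p < 6 by move=> l00; rewrite l00 ltxx in l0.
  have [u su _] := solex lambda t (ltW l0) ln0 t0 ht.
  exists u; split=> // v sv.
  have [u0 _ hu _] := solE _ _ su; have [v0 _ hv _] := solE _ _ sv.
  apply: solinj su sv _; apply: (height_inj b0 ba u0 v0 (c := 2 / p)).
    by rewrite -/(H _) hu.
  by rewrite -!/(H _) hu hv.
- move=> qp lambda l0.
  have ln0 : lambda = 0 -> p < 6 by move=> l00; rewrite l00 ltxx in l0.
  (* Here the two exponents of [height] coincide. *)
  have HE (t : R) : 0 < t -> H t = t `^ (p - 2) * (4^-1 - 2 / p).
    move=> t0; rewrite /H height_factorl//.
    have -> : 2 * (q - 2) - (p - 2) = 0 by rewrite qp; field.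
    by rewrite powRr0 mul1r.
  have p8E : (0 < 4^-1 - 2 / p) = (8 < p).
    have -> : 4^-1 - 2 / p = (p - 8) / (4 * p) by field; lra.
    by rewrite pmulr_lgt0 ?subr_gt0// invr_gt0 mulr_gt0//; lra.
  have p8 u : positive_solution p q lambda u -> 8 < p.
    move=> /solE[u0 _ hu _]; rewrite -p8E -(pmulr_rgt0 _ (powR_gt0 (p - 2) u0)).
    by rewrite -HE// hu.
  split; last first.
    move=> u v su sv.
    have [u0 _ hu _] := solE _ _ su; have [v0 _ hv _] := solE _ _ sv.
    have := p8 u su; rewrite -p8E => k0.
    apply: solinj su sv _; apply: (powR_inj (lt0r_neq0 b0) u0 v0).
    by apply: (mulIf (lt0r_neq0 k0)); rewrite -!HE// hu hv.
  split=> [[u /p8//]|]; rewrite -p8E => k0.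
  have [t t0 tE] := powR_root (lt0r_neq0 b0) (divr_gt0 l0 k0).
  have [|u su _] := solex lambda t (ltW l0) ln0 t0.
    by rewrite HE// tE divfK// gt_eqF.
  by exists u.
- move=> qp.
  have ab : 2 * (q - 2) < p - 2 by lra.
  have [s [s0 hs hmax hmaxU htwo]] := height_two_roots a0 ab p0.
  have ln0 (lambda : R) : 0 < lambda -> lambda = 0 -> p < 6.
    by move=> l0 l00; rewrite l00 ltxx in l0.
  (* The threshold is the maximum of [H], attained only at [s]. *)
  exists (H s); split; first exact: hs; split; [|split].
  + move=> lambda ls [u /(nontrivial_solution_height hp)[t t0 [_ ht]]].
    by have := hmax t t0; rewrite ht leNgt ls.
  + have [u su us] := solex (H s) s (ltW hs) (ln0 _ hs) s0 erefl.
    exists u; split=> // v sv; have [v0 _ hv _] := solE _ _ sv.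
    by apply: solinj su sv _; rewrite us; apply/esym; exact: hmaxU.
  + move=> lambda l0 ls; have [x [y [x0 xy hx hy hxy]]] := htwo lambda l0 ls.
    have y0 : 0 < y by exact: lt_trans xy.
    have [u su ux] := solex lambda x (ltW l0) (ln0 _ l0) x0 hx.
    have [v sv vy] := solex lambda y (ltW l0) (ln0 _ l0) y0 hy.
    exists u, v; split.
      by move=> uv; move: xy; rewrite -ux -vy uv ltxx.
    move=> w; split=> [sw|[->|->]//].
    have [w0 _ hw _] := solE _ _ sw.
    by case: (hxy _ w0 hw) => wE; [left|right]; apply: solinj sw _ _ => //;
      rewrite wE.
Qed.
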